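(* For every integer $g\ge 1$ there is a short exact sequence of chain complexes of $\mathbb{Q}$-vector spaces $$0\longrightarrow P^{(g-1)}_\bullet\longrightarrow P^{(g)}_\bullet\xrightarrow{\ \pi\ }V^{(g)}_\bullet\longrightarrow 0,$$ where $P^{(g)}_\bullet$ is the perfect chain complex, $V^{(g)}_\bullet$ is the Voronoi chain complex, and $\pi$ is the natural surjection sending $e_\sigma\mapsto e_\sigma$ if $\sigma$ meets $\Omega_g$ and $e_\sigma\mapsto 0$ otherwise.
   Context: Perfect cones. Identify quadratic forms on $\mathbb{R}^g$ with symmetric real $g\times g$ matrices. $\Omega_g$ is the cone of positive definite forms and $\Omega_g^{\mathrm{rt}}$ the set of positive semidefinite forms whose kernel is defined over $\mathbb{Q}$. $h\in\mathrm{GL}_g(\mathbb{Z})$ acts by $Q\mapsto hQh^t$. For $Q\in\Omega_g$ let $M(Q)$ be the set of nonzero vectors of $\mathbb{Z}^g$ at which $Q$ attains its minimum on $\mathbb{Z}^g\setminus\{0\}$, and $\sigma[Q]=\mathbb{R}_{\ge0}\langle \xi\xi^t:\xi\in M(Q)\rangle$. $\Sigma_g^{\mathrm P}$ is the set of all cones $\sigma[Q]$, $Q\in\Omega_g$, together with $\{0\}$; its elements are called perfect cones. It is a $\mathrm{GL}_g(\mathbb{Z})$-invariant collection of rational polyhedral cones, closed under taking faces, any two meeting along a common face, with finitely many orbits and union $\Omega_g^{\mathrm{rt}}$. The dimension of a cone is that of its linear span. Orientations. An orientation of a cone is an orientation of its linear span. If $\rho$ is a facet of $\sigma$ and $\omega_\sigma$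 an orientation of $\sigma$, the induced orientation $\omega_\sigma|_\rho$ is represented by an ordered basis $(v_1,\dots,v_n)$ of $\mathbb{R}\rho$ such that $(v_1,\dots,v_n,v)$ is positive for $\omega_\sigma$, where $v$ is a generator of any ray of $\sigma$ not in $\rho$. A cone $\sigma\in\Sigma_g^{\mathrm P}$ is alternating if every element of $\mathrm{GL}_g(\mathbb{Z})$ stabilizing $\sigma$ acts on it preserving orientation. Complexes. For each $n$ let $\Gamma_n=\Gamma_n^{(g)}$ be a set of representatives of the $\mathrm{GL}_g(\mathbb{Z})$-orbits of alternating cones of dimension $n+1$ in $\Sigma_g^{\mathrm P}$. Choose orientations $\omega_\sigma$ for $\sigma\in\Gamma_n$, and extend them to all alternating cones by the $\mathrm{GL}_g(\mathbb{Z})$-action. For $\sigma\in\Gamma_n$, $\sigma'\in\Gamma_{n-1}$ set $\delta(\sigma',\sigma)=\sum_\rho\eta(\rho,\sigma)$, the sum over facets $\rho$ of $\sigma$ in the $\mathrm{GL}_g(\mathbb{Z})$-orbit of $\sigma'$, with $\eta(\rho,\sigma)=1$ if $\omega_\rho=\omega_\sigma|_\rho$ and $-1$ otherwise. The perfect chain complex $P^{(g)}_\bullet$ has $P^{(g)}_n=\mathbb{Q}$-vector space with basis $\{e_\sigma:\sigma\in\Gamma_n\}$ and $\partial e_\sigma=\sum_{\sigma'\in\Gamma_{n-1}}\delta(\sigma',\sigma)e_{\sigma'}$. It is well defined up to isomorphism. ($P^{(0)}_\bullet$ is $\mathbb{Q}$ in degree $-1$.) Let $\overline\Gamma_n\subseteq\Gamma_n$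 be the subset of cones $\sigma$ with $\sigma\cap\Omega_g\neq\emptyset$. The Voronoi complex $V^{(g)}_\bullet$ has $V^{(g)}_n$ with basis $\{e_\sigma:\sigma\in\overline\Gamma_n\}$ and $d e_\sigma=\sum_{\sigma'\in\overline\Gamma_{n-1}}\delta(\sigma',\sigma)e_{\sigma'}$. *)

(* Defs.v *)
From HB Require Import structures.
From mathcomp Require Export all_boot all_order all_algebra.
From mathcomp Require Export all_classical all_reals.
From mathcomp.multinomials Require Export freeg.

Set Implicit Arguments.
Unset Strict Implicit.
Unset Printing Implicit Defensive.

Import Order.TTheory GRing.Theory Num.Theory.
Local Open Scope classical_set_scope.
Local Open Scope ring_scope.

Section Cones.
Variables (R : realType) (V : vectType R).
Implicit Types (C rho sigma : set V) (U : {vspace V}) (o : set (seq V)).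

Definition conic_hull (S : set V) : set V :=
  [set v | exists n (s : 'I_n -> V) (c : 'I_n -> R),
     [/\ forall i, S (s i), forall i, 0 <= c i & v = \sum_i c i *: s i]].

Definition is_lspan C U :=
  (forall v, C v -> v \in U) /\
  (forall W : {vspace V}, (forall v, C v -> v \in W) -> (U <= W)%VS).

(* The default value 0 is never used, by [lspanP] below. *)
Definition lspan C : {vspace V} := xget 0%VS [set U | is_lspan C U].

Definition cone_dim C : nat := \dim (lspan C).

Lemma lspanP C : is_lspan C (lspan C).
Proof.
rewrite /lspan; case: xgetP => // noU.
have [U [UC Umax]] : exists U, is_lspan C U; last by case: (noU U).
pose P k := `[< exists X : seq V,
  [/\ size X = k, free X & forall v, v \in X -> C v] >].
have P0 : exists k, P k by exists 0%N; apply/asboolP; exists [::]; rewrite nil_free.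
have Pub k : P k -> (k <= \dim {:V})%N.
  move=> /asboolP[X [<- fX _]].
  by rewrite -(eqnP fX) dimvS // subvf.
case: (ex_maxnP P0 Pub) => k /asboolP[X [sX fX XC]] kmax.
exists <<X>>%VS; split=> [v Cv|W CW]; last first.
  by apply/span_subvP => v /XC /CW.
apply: contrapT => /negP vX.
have /kmax : P k.+1.
  apply/asboolP; exists (v :: X); split => /=; first by rewrite sX.
    by rewrite free_cons vX.
  by move=> w; rewrite inE => /orP[/eqP->|/XC].
by rewrite ltnn.
Qed.

(* Faces are cut out by supporting hyperplanes; the zero functional gives
   [sigma] itself. *)
Definition is_face rho sigma := exists l : {scalar V},
  (forall v, sigma v -> 0 <= l v) /\ rho = [set v | sigma v /\ l v = 0].

Definition is_facet rho sigma :=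
  is_face rho sigma /\ (cone_dim rho).+1 = cone_dim sigma.

Definition ray_generator sigma v :=
  v != 0 /\ exists rho, [/\ is_face rho sigma, cone_dim rho = 1%N & rho v].

Definition basis_change_det (X Y : seq V) : R :=
  \det (\matrix_(i < size X, j < size X) coord (in_tuple X) j Y`_i).

(* An orientation is represented by its set of positive ordered bases.  In
   dimension 0 the only ordered basis is the empty one, and there are, as usual,
   two orientations: [set [::]] (positive) and set0 (negative). *)
Definition is_orientation U o :=
  (forall X, o X -> basis_of U X) /\
  (forall X Y, basis_of U X -> basis_of U Y ->
     (0 < basis_change_det X Y -> (o X <-> o Y)) /\
     (basis_change_det X Y < 0 -> (o X <-> ~ o Y))).

Definition induced_orientation sigma o rho : set (seq V) :=
  [set X | basis_of (lspan rho) X /\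
     exists v, [/\ ray_generator sigma v, ~ rho v & o (rcons X v)]].

End Cones.

Section PerfectCones.
Variables (R : realType) (g : nat).
Local Notation form := 'M[R]_g.
Implicit Types (Q : form) (h : 'M[int]_g) (rho sigma : set form).

Definition intcv (x : 'cV[int]_g) : 'cV[R]_g := map_mx intr x.

Definition qform Q (x : 'cV[R]_g) : R := (x^T *m Q *m x) 0 0.

Definition Omega : set form :=
  [set Q | Q^T = Q /\ forall x, x != 0 -> 0 < qform Q x].

Definition min_vectors Q : set 'cV[int]_g :=
  [set x | x != 0 /\
     forall y, y != 0 -> qform Q (intcv x) <= qform Q (intcv y)].

Definition sigma_cone Q : set form :=
  conic_hull [set intcv x *m (intcv x)^T | x in min_vectors Q].

Definition perfect_cone sigma :=
  sigma = [set 0] \/ exists2 Q, Omega Q & sigma = sigma_cone Q.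

(* GL_g(Z) is the set of [h : 'M[int]_g] such that [h \in unitmx]. *)
Definition gl_act h Q : form := map_mx intr h *m Q *m (map_mx intr h)^T.

Definition gl_act_cone h sigma : set form := gl_act h @` sigma.

Definition gl_act_orientation h (o : set (seq form)) : set (seq form) :=
  map (gl_act h) @` o.

Definition same_orbit sigma rho :=
  exists2 h, h \in unitmx & rho = gl_act_cone h sigma.

Definition alternating sigma :=
  perfect_cone sigma /\
  forall h, h \in unitmx -> gl_act_cone h sigma = sigma ->
  forall o, is_orientation (lspan sigma) o -> gl_act_orientation h o = o.

(* The choices entering the definition of the complexes: orbit representatives
   in each degree n (cones of dimension n + 1), and their orientations. *)
Record cone_choice := ConeChoice {
  Gamma : int -> set (set form);
  omega : set form -> set (seq form);
  Gamma_alternating : forall n sigma, Gamma n sigma ->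
    alternating sigma /\ (cone_dim sigma)%:Z = n + 1;
  Gamma_representative : forall n sigma,
    alternating sigma -> (cone_dim sigma)%:Z = n + 1 ->
    exists! tau, Gamma n tau /\ same_orbit tau sigma;
  omega_orientation : forall n sigma, Gamma n sigma ->
    is_orientation (lspan sigma) (omega sigma) }.

Variable D : cone_choice.

(* Extension of [omega D] to all alternating cones: the union is over all ways
   of writing [rho] as a translate of a chosen representative, all of which give
   the same orientation when [rho] is alternating. *)
Definition ext_omega rho : set (seq form) :=
  [set X | exists n sigma h, [/\ Gamma D n sigma, h \in unitmx,
     rho = gl_act_cone h sigma & gl_act_orientation h (omega D sigma) X]].

Definition eta rho sigma : rat :=
  if `[< ext_omega rho = induced_orientation sigma (ext_omega sigma) rho >]
  then 1 else -1.

(* The big operator over a set is 0 when infinitely many terms are nonzero; this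
   does not happen here, as a polyhedral cone has finitely many facets. *)
Definition delta sigma' sigma : rat :=
  \sum_(rho \in [set rho | is_facet rho sigma /\ same_orbit sigma' rho])
    eta rho sigma.

Definition Gamma_bar n : set (set form) :=
  [set sigma | Gamma D n sigma /\ sigma `&` Omega !=set0].

End PerfectCones.

Section FreeLift.
Variables (K : choiceType) (M : lmodType rat) (f : K -> M).

Lemma fglift_additive : zmod_morphism (fglift f).
Proof. exact: lift_is_additive. Qed.

HB.instance Definition _ :=
  GRing.isZmodMorphism.Build {freeg K / rat} M (fglift f) fglift_additive.

Lemma fglift_scalable : scalable (fglift f).
Proof.
move=> a x; have -> : a *: x = fgscale a x by [].
rewrite -[x in RHS]freeg_sumE /fgscale !raddf_sum /=.
by apply: eq_bigr => k _; rewrite !liftU scalerA.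
Qed.

HB.instance Definition _ :=
  GRing.isScalable.Build rat {freeg K / rat} M *:%R (fglift f) fglift_scalable.

Definition free_lift : {linear {freeg K / rat} -> M} := fglift f.

End FreeLift.

Record precomplex := Precomplex {
  term :> int -> lmodType rat;
  diff : forall n, {linear term n -> term (n - 1)} }.

Definition is_complex (A : precomplex) :=
  forall n (x : A n), diff A (n - 1) (diff A n x) = 0.

Definition graded_map (A B : precomplex) := forall n, {linear A n -> B n}.

Definition is_chain_map (A B : precomplex) (f : graded_map A B) :=
  forall n (x : A n), f (n - 1) (diff A n x) = diff B n (f n x).

Definition short_exact_sequence (A B C : precomplex)
    (i : graded_map A B) (p : graded_map B C) :=
  [/\ is_complex A, is_complex B & is_complex C] /\
  [/\ is_chain_map i, is_chain_map p &
      forall n, [/\ injective (i n),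
                    range (i n) = [set y | p n y = 0] &
                    range (p n) = setT]].

(* [B n] is the set of cones indexing the basis in degree n; the basis vector
   e_sigma of {freeg B n / rat} is << sigma >>. *)
Definition cone_complex (T : Type) (B : int -> set (set T))
    (d : set T -> set T -> rat) : precomplex :=
  @Precomplex (fun n => {freeg (B n) / rat}) (fun n =>
    @free_lift (B n) {freeg (B (n - 1)) / rat} (fun sigma =>
      \sum_(sigma' \in [set: B (n - 1)])
        d (val sigma') (val sigma) *: << sigma' >>)).

Section Complexes.
Variables (R : realType) (g : nat) (D : cone_choice R g).

Definition perfect_complex : precomplex := cone_complex (Gamma D) (delta D).

Definition voronoi_complex : precomplex :=
  cone_complex (Gamma_bar D) (delta D).

(* [insub (val sigma)] is [sigma] seen in [Gamma_bar D n] if [sigma] meets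
   [Omega], and [None] otherwise. *)
Definition voronoi_proj : graded_map perfect_complex voronoi_complex :=
  fun n => @free_lift (Gamma D n) {freeg (Gamma_bar D n) / rat} (fun sigma =>
    if insub (val sigma) is Some tau then << (tau : Gamma_bar D n) >> else 0).

End Complexes.

(* Main.v *)
(**
The boundary of a perfect cone is computed in the coinvariants: the class of a
cone is [± e] for the representative of its orbit, and [0] if the cone is not
alternating.  The formula
[d [sigma] = sum over facets rho of (incidence sign) [rho]] then holds for every
perfect cone, alternating or not, and [d d = 0] follows because a face of
codimension two lies in exactly two facets, with opposite signs.

A matrix [A] over the integers with a left inverse acts by [Q |-> A Q A^T]; this
covers both the action of [GL_g(Z)] and the inclusion of forms in [g - 1]
variables.  It preserves perfect cones, and two perfect cones become equivalent
in the larger space only if they were equivalent before, since integer matrices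
generating the same row lattice differ by a unimodular matrix.  A perfect cone
[sigma[Q]] missing the positive definite forms has minimal vectors of rank less
than [g], so by the Smith normal form it is equivalent to the image of a perfect
cone in [g - 1] variables.  Up to signs the sequence therefore splits in each
degree on basis vectors.
*)

From HB Require Import structures.
Require Import Defs.
From mathcomp Require Import finmap perm zify ring lra.

Set Implicit Arguments.
Unset Strict Implicit.
Unset Printing Implicit Defensive.

Import Order.TTheory GRing.Theory Num.Theory.
Local Open Scope classical_set_scope.
Local Open Scope ring_scope.

(** * Bases and orientations *)

(** The data chosen on the two sides are independent: the image of a representative need not be a
    representative, and its transported orientation need not be the chosen one. So [inclusion] sends
    a generator to the class of its image times [widen_sign], and the chain map property becomes a
    statement on how incidence signs react to a change of orientation. Computing [d d] meets the
    facets of a representative, which are in general neither representatives nor alternating. This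
    forces a boundary formula for all perfect cones, with [orient] supplying an orientation where
    none is chosen. That facets are again perfect is proved by perturbing the form. A unimodular [k]
    matching two widened cones may move the sublattice of [g - 1] variables. It is replaced by a
    unimodular matrix in [g - 1] variables that agrees with it on the span of the cone; this
    controls orbits and orientations at the same time. The Voronoi complex gets no boundary
    computation of its own: [d d = 0] descends along the surjection. *)

Section Bases.
Variables (R : realType) (V : vectType R).
Implicit Types (U : {vspace V}) (X Y Z : seq V) (o : set (seq V)).

Lemma basis_change_detE n (M : 'M[R]_n) X Y : size X = n -> free X ->
  (forall i : 'I_n, Y`_i = \sum_j M i j *: X`_j) ->
  basis_change_det X Y = \det M.
Proof.
move=> sX; subst n => fX YE; congr (\det _); apply/matrixP => i j.
by rewrite mxE YE (coord_sum_free _ _ (fX : free (in_tuple X))).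
Qed.

Lemma size_basis_of U X : basis_of U X -> size X = \dim U.
Proof. by move=> bX; rewrite -(span_basis bX) (eqnP (basis_free bX)). Qed.

Lemma basis_expand n U X Y : basis_of U X -> size X = n ->
  (forall y, y \in Y -> y \in U) ->
  exists M : 'M[R]_n, forall i : 'I_n, Y`_i = \sum_j M i j *: X`_j.
Proof.
move=> bX sX YU; subst n.
exists (\matrix_(i, j) coord (in_tuple X) j Y`_i) => i.
have YiU : Y`_i \in U.
  by have [iY|iY] := ltnP i (size Y); [exact/YU/mem_nth|rewrite nth_default ?mem0v].
rewrite {1}(coord_basis (bX : basis_of U (in_tuple X)) YiU).
by apply: eq_bigr => j _; rewrite mxE.
Qed.

Lemma basis_change_det_mul U X Y Z : basis_of U X -> basis_of U Y ->
  (forall z, z \in Z -> z \in U) ->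
  basis_change_det X Z = basis_change_det Y Z * basis_change_det X Y.
Proof.
move=> bX bY ZU.
have sX := size_basis_of bX; have sY := size_basis_of bY.
have YU y : y \in Y -> y \in U by move=> /(basis_mem bY).
have [M YE] := basis_expand bX sX YU.
have [N ZE] := basis_expand bY sY ZU.
rewrite (basis_change_detE sX (basis_free bX) YE).
rewrite (basis_change_detE sY (basis_free bY) ZE) -det_mulmx.
apply: (basis_change_detE sX (basis_free bX)) => i.
rewrite ZE; under eq_bigr => j _ do rewrite YE scaler_sumr.
rewrite exchange_big; apply: eq_bigr => k _ /=.
by rewrite mxE scaler_suml; apply: eq_bigr => j _; rewrite scalerA.
Qed.

Lemma basis_change_det_id X : free X -> basis_change_det X X = 1.
Proof.
move=> fX; rewrite (@basis_change_detE (size X) 1%:M) ?det1 // => i.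
rewrite (bigD1 i) //= mxE eqxx scale1r big1 ?addr0 // => j /negPf ji.
by rewrite mxE eq_sym ji scale0r.
Qed.

Lemma basis_change_det_neq0 U X Y : basis_of U X -> basis_of U Y ->
  basis_change_det X Y != 0.
Proof.
move=> bX bY; apply/eqP => d0; have /eqP := basis_change_det_id (basis_free bX).
rewrite (basis_change_det_mul bX bY) ?d0 ?mulr0 1?eq_sym ?oner_eq0 //.
by move=> z /(basis_mem bX).
Qed.

(** Modulo [U] the added vector [w] is [c *: v], so the change of basis is block triangular with
    last diagonal entry [c]. *)
Lemma basis_change_det_rcons U X Y v w c :
  basis_of U X -> basis_of U Y -> free (rcons X v) -> w - c *: v \in U ->
  basis_change_det (rcons X v) (rcons Y w) = basis_change_det X Y * c.
Proof.
move=> bX bY fXv wv.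
have sX := size_basis_of bX; have sY := size_basis_of bY.
have YU y : y \in Y -> y \in U by move=> /(basis_mem bY).
have [M YE] := basis_expand bX sX YU.
have [|N ZE] := @basis_expand _ _ _ (nseq (\dim U) (w - c *: v)) bX sX.
  by move=> z /nseqP[->].
rewrite (basis_change_detE sX (basis_free bX) YE).
have [r wE] : exists r : 'rV[R]_(\dim U), w - c *: v = \sum_j r 0 j *: X`_j.
  exists (\row_j coord (in_tuple X) (cast_ord (esym sX) j) (w - c *: v)).
  rewrite [LHS](coord_basis (bX : basis_of U (in_tuple X)) wv).
  rewrite (reindex (cast_ord (esym sX))) /=; last first.
    by exists (cast_ord sX) => k _; rewrite ?cast_ordK ?cast_ordKV.
  by apply: eq_bigr => j _; rewrite mxE.
have -> : \det M * c = \det (block_mx M 0 r (c%:M : 'M_1)).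
  by rewrite det_lblock det_scalar expr1.
apply: basis_change_detE => //; first by rewrite size_rcons sX addn1.
move=> i; rewrite big_split_ord /= big_ord1 !nth_rcons sX sY addn0 ltnn eqxx.
case: (splitP i) => [k ik|k ik].
  have -> : i = lshift 1 k by apply: val_inj.
  rewrite block_mxEur mxE scale0r addr0 YE; apply: eq_bigr => j _.
  by rewrite block_mxEul nth_rcons sX ltn_ord.
have -> : i = rshift (\dim U) k by apply: val_inj.
rewrite ord1 /= addn0 eqxx block_mxEdr mxE eqxx mulr1n.
rewrite -[LHS](subrK (c *: v)) wE; congr (_ + _); apply: eq_bigr => j _.
by rewrite block_mxEdl nth_rcons sX ltn_ord.
Qed.

(** The change of basis is a transposition; this is the source of the minus sign in [d d = 0]. *)
Lemma basis_change_det_swap X a b : free (rcons (rcons X a) b) ->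
  basis_change_det (rcons (rcons X a) b) (rcons (rcons X b) a) = -1.
Proof.
move=> fXab; pose n := size X.
have n1 : (n < n.+2)%N by exact: leqnSn.
have n2 : (n.+1 < n.+2)%N by [].
pose s := tperm (Ordinal n1) (Ordinal n2).
have -> : -1 = \det (perm_mx s : 'M[R]_n.+2).
  by rewrite det_perm odd_tperm -val_eqE /= neq_ltn leqnn expr1.
apply: basis_change_detE => //; first by rewrite !size_rcons.
move=> i; rewrite (bigD1 (s i)) //= big1 => [|j /negPf js]; last first.
  by rewrite !mxE eq_sym js scale0r.
rewrite !mxE eqxx scale1r addr0 !nth_rcons !size_rcons -/n /s.
case: tpermP => [->|->|] /=; rewrite ?ltnn ?ltnS ?leqnn ?eqxx ?ltnn //=.
move=> /eqP i1 /eqP i2; rewrite -!val_eqE /= in i1 i2.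
have := ltn_ord i; rewrite ltnS leq_eqVlt (negPf i2) /= ltnS => iS; rewrite iS.
by move: iS; rewrite leq_eqVlt (negPf i1) /= => ->.
Qed.

(** Turns the encoding of an orientation as a set of bases into a sign that can be multiplied. It is
    meaningful on bases only; on other sequences an orientation gives -1. *)
Definition basis_sign o X : rat := if `[< o X >] then 1 else -1.

Lemma basis_sign_sqr o X : basis_sign o X * basis_sign o X = 1.
Proof. by rewrite /basis_sign; case: ifP; rewrite ?mulrNN mulr1. Qed.

Lemma basis_sign_eq o o' X : (o X <-> o' X) -> basis_sign o X = basis_sign o' X.
Proof. by move=> oo'; rewrite /basis_sign (asbool_equiv_eq oo'). Qed.

Lemma basis_signP o o' X : basis_sign o X = basis_sign o' X -> (o X <-> o' X).
Proof.
rewrite /basis_sign; case: asboolP; case: asboolP => // *; lra.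
Qed.

Lemma basis_sign_orientation U o X Y : is_orientation U o ->
  basis_of U X -> basis_of U Y ->
  basis_sign o Y = (if 0 < basis_change_det X Y then 1 else -1) * basis_sign o X.
Proof.
move=> [_ oP] bX bY; have [pos neg] := oP _ _ bX bY.
rewrite /basis_sign; case: ltrgtP (basis_change_det_neq0 bX bY) => // d _.
  by rewrite mul1r (asbool_equiv_eq (pos d)).
rewrite (asbool_equiv_eq (neg d)) asbool_neg.
by case: asboolP; rewrite /= ?mulrNN mulr1.
Qed.

Lemma orientation_eq U o o' X : is_orientation U o -> is_orientation U o' ->
  basis_of U X -> (o X <-> o' X) -> o = o'.
Proof.
move=> oU oU' bX /basis_sign_eq oo'.
have oP Y : basis_of U Y -> (o Y <-> o' Y).
  move=> bY; apply: basis_signP; rewrite (basis_sign_orientation oU bX bY).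
  by rewrite (basis_sign_orientation oU' bX bY) oo'.
apply/seteqP; split=> Y oY.
  by apply/oP => //; case: oU => + _; apply.
by apply/oP => //; case: oU' => + _; apply.
Qed.

(** There are only two orientations, so one basis decides whether they agree. This converts the
    equality test inside [eta] into a product of signs. *)
Lemma orientation_asbool_eq U o o' X : is_orientation U o ->
  is_orientation U o' -> basis_of U X ->
  (if `[< o = o' >] then 1 else -1) = basis_sign o X * basis_sign o' X.
Proof.
move=> oU oU' bX; case: asboolP => [->|oo']; first by rewrite basis_sign_sqr.
have {}oo' : ~ (o X <-> o' X) by move=> /(orientation_eq oU oU' bX).
rewrite /basis_sign; case: (asboolP (o X)) => oX; case: (asboolP (o' X)) => o'X;
  rewrite ?mulr1 ?mul1r //; by exfalso; tauto.
Qed.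

Definition basis_orientation U X : set (seq V) :=
  [set Y | basis_of U Y /\ 0 < basis_change_det X Y].

Lemma basis_orientationP U X : basis_of U X ->
  is_orientation U (basis_orientation U X).
Proof.
move=> bX; split=> [Y []//|Y Z bY bZ].
have ZU z : z \in Z -> z \in U by move=> /(basis_mem bZ).
have := basis_change_det_mul bX bY ZU => E.
have nz := basis_change_det_neq0 bX bY.
split=> d; rewrite /basis_orientation /= E; split.
- by move=> [_ p]; split=> //; rewrite mulr_gt0.
- by move=> [_]; rewrite pmulr_rgt0.
- by move=> [_ p] [_]; rewrite nmulr_rgt0 // ltNge ltW.
- move=> np; split=> //; case: ltrgtP nz => // p _.
  by case: np; split=> //; rewrite nmulr_rgt0.
Qed.

End Bases.

(** * Transport of orientations along a linear map with a left inverse *)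

Section OrientationTransport.
Variables (R : realType) (V W : vectType R).
Variables (f : {linear V -> W}) (f' : {linear W -> V}).
Hypothesis fK : cancel f f'.
Implicit Types (U : {vspace V}) (X Y : seq V) (o : set (seq V)).

Let mapfE X : map (linfun f) X = map f X.
Proof. by apply: eq_map => v; rewrite lfunE. Qed.

Lemma basis_of_map U X : basis_of U X -> basis_of (linfun f @: U) (map f X).
Proof.
rewrite -mapfE; apply: limg_basis_of.
suff /eqP -> : lker (linfun f) == 0%VS by rewrite capv0.
by apply/lker0P => v w; rewrite !lfunE => /(can_inj fK).
Qed.

Lemma mem_map_space U v : (f v \in (linfun f @: U)%VS) = (v \in U).
Proof.
apply/idP/idP => [/memv_imgP[u uU]|vU]; last by rewrite -(lfunE f) memv_img.
by rewrite lfunE => /(can_inj fK) ->.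
Qed.

Lemma dim_map_space U : \dim (linfun f @: U) = \dim U.
Proof.
rewrite -(size_basis_of (basis_of_map (vbasisP U))) size_map.
by rewrite (size_basis_of (vbasisP U)).
Qed.

Lemma map_space_seq U (Y : seq W) :
  (forall y, y \in Y -> y \in (linfun f @: U)%VS) ->
  exists2 X, Y = map f X & forall x, x \in X -> x \in U.
Proof.
move=> YU; exists (map f' Y).
  rewrite -map_comp -[LHS]map_id; apply/eq_in_map => y /YU /memv_imgP[u _ ->].
  by rewrite /= lfunE fK.
move=> x /mapP[y /YU /memv_imgP[u uU ->] ->].
by rewrite lfunE fK.
Qed.

Lemma basis_of_mapE U X : basis_of (linfun f @: U) (map f X) -> basis_of U X.
Proof.
move=> bfX; rewrite basisEdim -(dim_map_space U) -(size_basis_of bfX) size_map leqnn andbT.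
have := span_basis bfX; rewrite -mapfE -limg_span => E.
by apply/subvP => v vU; rewrite -mem_map_space E mem_map_space.
Qed.

Lemma basis_change_det_map U X Y : basis_of U X ->
  (forall y, y \in Y -> y \in U) ->
  basis_change_det (map f X) (map f Y) = basis_change_det X Y.
Proof.
move=> bX YU; have [M YE] := basis_expand bX erefl YU.
rewrite (basis_change_detE erefl (basis_free bX) YE).
apply: basis_change_detE; first by rewrite size_map.
  exact: basis_free (basis_of_map bX).
have nthf (Z : seq V) i : (map f Z)`_i = f Z`_i.
  have [iZ|iZ] := ltnP i (size Z); first by rewrite (nth_map 0).
  by rewrite !nth_default ?size_map ?linear0.
move=> i; rewrite nthf YE linear_sum; apply: eq_bigr => j _.
by rewrite linearZ /= nthf.
Qed.

Lemma orientation_map U o : is_orientation U o ->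
  is_orientation (linfun f @: U) (map f @` o).
Proof.
have mapI : injective (map f) by apply: inj_map; apply: can_inj fK.
have imE (X : seq V) : (map f @` o) (map f X) <-> o X.
  by split=> [[Y oY /mapI <-]|oX] //; exists X.
move=> [ob oP]; split=> [_ [X /ob bX <-]|X' Y' bX' bY']; first exact: basis_of_map.
have [X XE _] := map_space_seq (fun x => basis_mem bX').
have [Y YE YU] := map_space_seq (fun x => basis_mem bY').
move: bX' bY'; rewrite XE YE => /basis_of_mapE bX /basis_of_mapE bY.
by rewrite (basis_change_det_map bX YU) !(propext (imE _)); exact: oP.
Qed.

Lemma basis_sign_map o X : basis_sign (map f @` o) (map f X) = basis_sign o X.
Proof.
congr (if _ then _ else _); apply/asbool_equiv_eq.
by split=> [[Y oY /(inj_map (can_inj fK)) <-]|oX] //; exists X.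
Qed.

End OrientationTransport.

(** * Polyhedral cones *)

Section Cones.
Variables (R : realType) (V : vectType R).
Implicit Types (C rho sigma tau : set V) (S X Y : seq V) (U : {vspace V}).
Implicit Types (l m : {scalar V}) (o : set (seq V)).

Lemma scalar_exists (f : V -> R) : scalar f -> exists l, l =1 f.
Proof.
move=> fP; pose aux := GRing.isLinear.Build R V R *%R f fP.
by exists (HB.pack f aux : {scalar V}).
Qed.

Lemma conic_hull_sub (S : set V) v : S v -> conic_hull S v.
Proof.
move=> Sv; exists 1%N, (fun=> v), (fun=> 1).
by split=> [//|_|]; rewrite ?ler01 // big_ord1 scale1r.
Qed.

Lemma conic_hull0 (S : set V) : conic_hull S 0.
Proof.
by exists 0%N, (fun=> 0), (fun=> 0); split=> [[]|[]|] //; rewrite big_ord0.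
Qed.

Lemma conic_hullD (S : set V) v w :
  conic_hull S v -> conic_hull S w -> conic_hull S (v + w).
Proof.
move=> [n [s [c [Ss c0 ->]]]] [n' [s' [c' [Ss' c'0 ->]]]].
exists (n + n')%N,
  (fun i : 'I_(n + n') => match fintype.split i with inl j => s j | inr j => s' j end),
  (fun i : 'I_(n + n') => match fintype.split i with inl j => c j | inr j => c' j end).
split=> [i|i|]; try by case: fintype.split.
rewrite big_split_ord; congr (_ + _); apply: eq_bigr => i _.
  by rewrite (unsplitK (inl i)).
by rewrite (unsplitK (inr i)).
Qed.

Lemma conic_hullZ (S : set V) k v : 0 <= k -> conic_hull S v -> conic_hull S (k *: v).
Proof.
move=> k0 [n [s [c [Ss c0 ->]]]]; exists n, s, (fun i => k * c i); split=> // [i|].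
  exact: mulr_ge0.
by rewrite scaler_sumr; apply: eq_bigr => i _; rewrite scalerA.
Qed.

Lemma conic_hull_ind (S : set V) (P : V -> Prop) : P 0 ->
  (forall v w, P v -> P w -> P (v + w)) ->
  (forall c v, S v -> 0 <= c -> P (c *: v)) ->
  forall v, conic_hull S v -> P v.
Proof.
move=> P0 PD PZ _ [n [s [c [Ss c0 ->]]]].
by elim/big_ind: _ => // i _; apply: PZ.
Qed.

Lemma lspan_mem C v : C v -> v \in lspan C.
Proof. by case: (lspanP C) => + _; apply. Qed.

Lemma lspan_sub C U : (forall v, C v -> v \in U) -> (lspan C <= U)%VS.
Proof. by case: (lspanP C) => _; apply. Qed.

Lemma lspan_unique C U : is_lspan C U -> lspan C = U.
Proof.
move=> [CU Umin]; apply/subv_anti; rewrite lspan_sub //=.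
by apply: Umin => v; exact: lspan_mem.
Qed.

Lemma lspan_conic_hull S : lspan (conic_hull [set` S]) = <<S>>%VS.
Proof.
apply: lspan_unique; split=> [|W SW].
  apply: conic_hull_ind => [|v w|c v /= vS _]; rewrite ?mem0v //; first exact: rpredD.
  by rewrite rpredZ // memv_span.
by apply/span_subvP => v vS; apply/SW/conic_hull_sub.
Qed.

Lemma lspan_scalar0 C l : (forall v, C v -> l v = 0) ->
  forall v, v \in lspan C -> l v = 0.
Proof.
move=> Cl v; have /subvP/(_ v)/[apply] : (lspan C <= lker (linfun (l : V -> R^o)))%VS.
  by apply: lspan_sub => w /Cl lw; rewrite memv_ker lfunE /= lw.
by rewrite memv_ker lfunE => /eqP.
Qed.

Lemma face_sub rho sigma v : is_face rho sigma -> rho v -> sigma v.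
Proof. by move=> [l [_ ->]] []. Qed.

Lemma facet_functional rho sigma : is_facet rho sigma ->
  exists l, [/\ rho = [set v | sigma v /\ l v = 0],
    forall v, sigma v -> 0 <= l v,
    forall v, v \in lspan rho -> l v = 0 &
    forall v, sigma v -> ~ rho v -> 0 < l v].
Proof.
move=> [[l [l0 rhoE]] _]; exists l; split=> //.
  by apply: lspan_scalar0 => v; rewrite rhoE => -[].
by move=> v sv; rewrite rhoE lt0r l0 // andbT => nv; apply/eqP => lv; apply: nv.
Qed.

Lemma facet_neq rho sigma : is_facet rho sigma -> exists2 v, sigma v & ~ rho v.
Proof.
move=> [fr dr]; apply: contrapT => nv.
suff rs : rho = sigma by move: dr; rewrite rs => /esym/n_Sn.
apply/seteqP; split=> v; first exact: face_sub.
by move=> sv; apply: contrapT => nr; apply: nv; exists v.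
Qed.

Lemma basis_of_rcons U U' X v : basis_of U X -> (U <= U')%VS -> v \in U' ->
  v \notin U -> \dim U' = (\dim U).+1 -> basis_of U' (rcons X v).
Proof.
move=> bX UU' vU' vU dU'; rewrite (@perm_basis _ _ _ (v :: X)); last exact/permPl/perm_rcons.
rewrite basisEfree free_cons (span_basis bX) vU (basis_free bX) /=.
rewrite dU' (size_basis_of bX) leqnn andbT; apply/span_subvP => w.
by rewrite inE => /predU1P[->//|/(basis_mem bX)]; exact/subvP.
Qed.

Lemma facet_lspan_sub rho sigma : is_facet rho sigma -> (lspan rho <= lspan sigma)%VS.
Proof. by move=> [fr _]; apply: lspan_sub => v /(face_sub fr); exact: lspan_mem. Qed.

Lemma facet_basis_rcons rho sigma X v : is_facet rho sigma ->
  basis_of (lspan rho) X -> sigma v -> ~ rho v ->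
  basis_of (lspan sigma) (rcons X v).
Proof.
move=> fr bX sv nrv; have [l [_ _ lr lv]] := facet_functional fr.
apply: (basis_of_rcons bX); [exact: facet_lspan_sub|exact: lspan_mem| |by case: fr].
by apply/negP => /lr lv0; have := lv v sv nrv; rewrite lv0 ltxx.
Qed.

Lemma facet_decomp rho sigma v w : is_facet rho sigma -> sigma v -> ~ rho v ->
  w \in lspan sigma -> exists c, w - c *: v \in lspan rho.
Proof.
move=> fr sv nrv; have bX := vbasisP (lspan rho).
rewrite -(span_basis (facet_basis_rcons fr bX sv nrv)).
rewrite (eq_span (mem_rcons _ _)) span_cons (span_basis bX).
move=> /memv_addP[_ /vlineP[c ->] [u ur ->]]; exists c.
by rewrite addrC addKr.
Qed.

(** The factor [c] is the quotient [l w / l v] for a functional [l] cutting out the facet; both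
    values are positive off [rho]. *)
Lemma facet_basis_change rho sigma X Y v w : is_facet rho sigma ->
  basis_of (lspan rho) X -> basis_of (lspan rho) Y ->
  sigma v -> ~ rho v -> sigma w -> ~ rho w ->
  exists2 c, 0 < c & basis_change_det (rcons X v) (rcons Y w) = basis_change_det X Y * c.
Proof.
move=> fr bX bY sv nrv sw nrw; have [l [_ _ lr lpos]] := facet_functional fr.
have [c cP] := facet_decomp fr sv nrv (lspan_mem sw).
exists c; last first.
  apply: (basis_change_det_rcons bX bY) => //.
  exact: basis_free (facet_basis_rcons fr bX sv nrv).
have /eqP := lr _ cP; rewrite linearB linearZ /= subr_eq0 => /eqP lw.
by have := lpos w sw nrw; rewrite lw pmulr_lgt0 // lpos.
Qed.

Lemma ray_generator_mem sigma v : ray_generator sigma v -> sigma v.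
Proof. by move=> [_ [rho [+ _ rv]]] => /face_sub; apply. Qed.

(** The definition completes a basis by a ray generator; any vector of [sigma] off [rho] gives the
    same answer, so points of neighbouring facets can be used. Some ray generator off [rho] must
    exist, or the induced set of bases would be empty. *)
Lemma induced_orientationE rho sigma o X v : is_facet rho sigma ->
  is_orientation (lspan sigma) o ->
  (exists w, ray_generator sigma w /\ ~ rho w) ->
  basis_of (lspan rho) X -> sigma v -> ~ rho v ->
  (induced_orientation sigma o rho X <-> o (rcons X v)).
Proof.
move=> fr [_ oP] [w0 [gw0 nw0]] bX sv nrv.
have oE w : sigma w -> ~ rho w -> (o (rcons X w) <-> o (rcons X v)).
  move=> sw nrw.
  have [c c0 cE] := facet_basis_change fr bX bX sw nrw sv nrv.
  have [+ _] := oP _ _ (facet_basis_rcons fr bX sw nrw) (facet_basis_rcons fr bX sv nrv).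
  by rewrite cE basis_change_det_id ?(basis_free bX) // mul1r; apply.
split=> [[_ [w [/ray_generator_mem sw nrw]]]|oXv]; first by rewrite oE.
by split=> //; exists w0; split=> //; apply/oE => //; exact: ray_generator_mem.
Qed.

Lemma induced_orientationP rho sigma o : is_facet rho sigma ->
  is_orientation (lspan sigma) o ->
  (exists w, ray_generator sigma w /\ ~ rho w) ->
  is_orientation (lspan rho) (induced_orientation sigma o rho).
Proof.
move=> fr oS ex; split=> [X []//|X Y bX bY]; have [w [gw nw]] := ex.
have sw := ray_generator_mem gw.
rewrite !(propext (induced_orientationE fr oS ex _ sw nw)) //.
have [c c0 cE] := facet_basis_change fr bX bY sw nw sw nw.
case: oS => _ /(_ _ _ (facet_basis_rcons fr bX sw nw) (facet_basis_rcons fr bY sw nw)).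
by rewrite cE pmulr_lgt0 // pmulr_llt0.
Qed.

(** Finite generation gives finitely many facets; generators lying on rays give a ray generator off
    each facet, as the induced orientation demands. *)
Definition pointed_cone C :=
  exists2 S : seq V, C = conic_hull [set` S] & forall s, s \in S -> ray_generator C s.

Lemma pointed_cone_ray rho sigma : pointed_cone sigma -> is_facet rho sigma ->
  exists w, ray_generator sigma w /\ ~ rho w.
Proof.
move=> [S sE gS] fr; have [l [rE l0 _ _]] := facet_functional fr.
apply: contrapT => nw; have [v sv] := facet_neq fr; apply.
rewrite rE; split=> //; move: sv; rewrite sE.
move: v; apply: conic_hull_ind => [|v w lv lw|c v vS _]; rewrite ?linear0 //.
  by rewrite linearD /= lv lw addr0.
have : rho v by apply: contrapT => nv; apply: nw; exists v; split=> //; exact: gS.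
by rewrite rE linearZ /= => -[_ ->]; rewrite mulr0.
Qed.

(** A sum of nonnegative terms vanishes only if each term does, so a combination on the face uses
    only generators on the face. *)
Lemma face_conic_hull S l : (forall v, conic_hull [set` S] v -> 0 <= l v) ->
  [set v | conic_hull [set` S] v /\ l v = 0] =
  conic_hull [set` seq.filter (fun v => l v == 0) S].
Proof.
move=> l0; apply/seteqP; split=> v /=.
  move=> [[n [s [c [sS c0 ->]]]]]; rewrite linear_sum /= => lv.
  have ge0 i : xpredT i -> 0 <= l (c i *: s i).
    by move=> _; apply: l0; apply: conic_hullZ => //; exact: conic_hull_sub.
  elim/big_ind: _ => [|u w|i _]; [exact: conic_hull0|exact: conic_hullD|].
  have /(_ i isT)/eqP := psumr_eq0P ge0 lv; rewrite linearZ mulf_eq0 => /orP[/eqP->|li].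
    by rewrite scale0r; exact: conic_hull0.
  apply: conic_hullZ => //; apply: conic_hull_sub.
  by rewrite /= mem_filter li; exact: sS.
move: v; apply: conic_hull_ind => [|v w [vC lv] [wC lw]|c v /=].
- by split; [exact: conic_hull0|rewrite linear0].
- by split; [exact: conic_hullD|rewrite linearD /= lv lw addr0].
rewrite mem_filter => /andP[/eqP lv vS] c0; split; last by rewrite linearZ /= lv mulr0.
by apply: conic_hullZ => //; exact: conic_hull_sub.
Qed.

Definition facets C : seq (set V) :=
  enum_fset (fset_set [set rho | is_facet rho C]).

(** A face is determined by the generators lying on it, hence by a bit mask on [S]. *)
Lemma finite_facets C : pointed_cone C -> finite_set [set rho | is_facet rho C].
Proof.
move=> [S -> _]; apply: (@sub_finite_set _ _
    ((fun m : (size S).-tuple bool => conic_hull [set` mask m S]) @` setT)).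
  move=> rho [[l [l0 ->]] _] /=; rewrite face_conic_hull //.
  exists (map_tuple (fun v => l v == 0) (in_tuple S)) => //.
  by rewrite /= filter_mask.
exact/finite_image/finite_finset.
Qed.

Lemma facetsP C rho : pointed_cone C -> reflect (is_facet rho C) (rho \in facets C).
Proof.
move=> /finite_facets fC; apply: (iffP idP) => rf.
  have : rho \in fset_set [set rho | is_facet rho C] by [].
  by rewrite in_fset_set // => /set_mem.
suff : rho \in fset_set [set rho | is_facet rho C] by [].
by rewrite in_fset_set //; exact: mem_set.
Qed.

Lemma facets_uniq C : uniq (facets C).
Proof. exact: fset_uniq. Qed.

Lemma seq_argmin (T : eqType) (s : seq T) (P : pred T) (f : T -> R) : has P s ->
  exists2 b, b \in s /\ P b & forall x, x \in s -> P x -> f b <= f x.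
Proof.
elim: s => //= x s IH; have [/IH[b [bs Pb] bmin] _|/hasPn nPs] := boolP (has P s).
  have [[Px fxb]|nx] := pselect (P x /\ f x < f b).
    exists x; first by rewrite mem_head.
    move=> y; rewrite inE => /predU1P[->//|ys Py].
    exact/ltW/(lt_le_trans fxb)/bmin.
  exists b; first by rewrite inE bs orbT.
  move=> y; rewrite inE => /predU1P[-> Px|ys Py]; last exact: bmin.
  by rewrite leNgt; apply/negP => fxb; apply: nx.
rewrite orbF => Px; exists x; first by rewrite mem_head.
move=> y; rewrite inE => /predU1P[->//|/nPs nPy Py].
by rewrite Py in nPy.
Qed.

(* With [rho] cut out by [l] and [tau] cut out of [rho] by [m], the other facet
   containing [tau] is cut out by [m - c l], where [c] is the minimal slope
   [m / l] among the generators outside [rho]. *)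
Lemma facet_diamond sigma rho tau : pointed_cone sigma ->
  is_facet rho sigma -> is_facet tau rho ->
  exists rho' a b, [/\ is_facet rho' sigma, is_facet tau rho',
    forall rho'', is_facet rho'' sigma -> is_facet tau rho'' ->
      rho'' = rho \/ rho'' = rho',
    [/\ rho a, ~ rho' a & ~ tau a] & [/\ rho' b, ~ rho b & ~ tau b]].
Proof.
move=> [S sE gS] fr ft.
have [l [rE l0 lr lpos]] := facet_functional fr.
have [m [tE m0 mt mpos]] := facet_functional ft.
have [a ra nta] := facet_neq ft.
have sub v : v \in S -> sigma v by rewrite sE; exact: conic_hull_sub.
have sa : sigma a by apply: face_sub ra; case: fr.
have la : l a = 0 by move: ra; rewrite rE => -[].
have ma := mpos a ra nta.
have /seq_argmin -/(_ (fun v => m v / l v))[b [bS lb] bmin] : has (fun v => 0 < l v) S.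
  rewrite -[has _ _]negbK; apply/negP => /hasPn nS.
  have [v sv []] := facet_neq fr; rewrite rE; split=> //; rewrite sE in sv.
  move: v sv; apply: conic_hull_ind => [|u w lu lw|c v vS _]; first exact: linear0.
    by rewrite linearD /= lu lw addr0.
  have := nS v vS; rewrite lt0r (l0 v (sub v vS)) andbT negbK => /eqP lv.
  by rewrite linearZ /= lv mulr0.
pose c := m b / l b.
have [m' m'E] : exists m' : {scalar V}, m' =1 (fun v => m v - c * l v).
  by apply: scalar_exists => k v w; rewrite !linearP /=; ring.
have m'0 v : sigma v -> 0 <= m' v.
  rewrite sE; move: v; apply: conic_hull_ind => [|v w lv lw|k v vS k0]; rewrite ?linear0 //.
    by rewrite linearD /= addr_ge0.
  rewrite linearZ /= mulr_ge0 // m'E; have [lv|lv|lv] := ltrgtP 0 (l v).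
  - by rewrite subr_ge0 -ler_pdivlMr // bmin.
  - by have := l0 v (sub v vS); rewrite leNgt lv.
  - by rewrite -lv mulr0 subr0 m0 // rE; split=> //; exact: sub.
have sb := sub b bS.
have m'b : m' b = 0 by rewrite m'E divfK ?subrr // gt_eqF.
have m'a : 0 < m' a by rewrite m'E la mulr0 subr0.
pose rho' := [set v | sigma v /\ m' v = 0].
have tE' v : sigma v -> (tau v <-> l v = 0 /\ m' v = 0).
  move=> sv; rewrite tE rE m'E /=; split=> [[[_ ->] ->]|[lv]]; first by rewrite mulr0 subr0.
  by rewrite lv mulr0 subr0.
have ts v : tau v -> sigma v by rewrite tE rE => -[[]].
have tr' v : tau v -> rho' v by move=> tv; split; [exact: ts|case/(tE' _ (ts _ tv)): tv].
have nrb : ~ rho b by rewrite rE => -[_ lb0]; rewrite lb0 ltxx in lb.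
have ntb : ~ tau b by move=> /(tE' _ sb)[lb0]; rewrite lb0 ltxx in lb.
have nra : ~ rho' a by move=> [_ ma0]; rewrite ma0 ltxx in m'a.
(* As [tau] has codimension two, a functional vanishing on it is a combination of [l] and [m']. The
   coefficients are read off at [b], where [m'] vanishes, and at [a], where [l] vanishes. *)
have T0 (f : {scalar V}) : (forall v, tau v -> f v = 0) ->
  forall w, sigma w -> f w = l w / l b * f b + m' w / m' a * f a.
  move=> f0; have {f0}fT := lspan_scalar0 f0.
  have lT := lspan_scalar0 (fun v tv => proj1 ((tE' v (ts v tv)).1 tv)).
  have m'T := lspan_scalar0 (fun v tv => proj2 ((tE' v (ts v tv)).1 tv)).
  move=> w sw; have [k kP] := facet_decomp fr sb nrb (lspan_mem sw).
  have [d dP] := facet_decomp ft ra nta kP.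
  have ev (h : {scalar V}) : h (w - k *: b - d *: a) = h w - k * h b - d * h a.
    by rewrite !linearB !linearZ.
  move: (fT _ dP) (lT _ dP) (m'T _ dP); rewrite !ev la m'b !mulr0 !subr0.
  move=> /eqP fw /eqP lw /eqP mw.
  move: fw lw mw; rewrite -addrA -opprD !subr_eq0 => /eqP -> /eqP -> /eqP ->.
  by rewrite !mulfK ?gt_eqF.
have bT : b \notin lspan tau.
  apply/negP => /(lspan_scalar0 (fun v tv => proj1 ((tE' v (ts v tv)).1 tv))) lb0.
  by rewrite lb0 ltxx in lb.
(* The condition [m' = 0] removes the component along [a], so [rho'] has dimension one more than
   [tau]. *)
have rho'E : lspan rho' = (<[b]> + lspan tau)%VS.
  apply/subv_anti/andP; split; last first.
    rewrite subv_add -memvE lspan_mem //=.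
    by apply: lspan_sub => v /tr'; exact: lspan_mem.
  apply: lspan_sub => w [sw mw].
  have [k kP] := facet_decomp fr sb nrb (lspan_mem sw).
  have [d dP] := facet_decomp ft ra nta kP.
  have m'T := lspan_scalar0 (fun v tv => proj2 ((tE' v (ts v tv)).1 tv)).
  have /eqP := m'T _ dP; rewrite !linearB !linearZ /= mw m'b.
  rewrite mulr0 subr0 sub0r oppr_eq0 mulf_eq0 (gt_eqF m'a) orbF => /eqP d0.
  rewrite d0 scale0r subr0 in dP.
  by apply/memv_addP; exists (k *: b); [exact: memvZ (memv_line b)|exists (w - k *: b)];
    rewrite // addrC subrK.
have dr' : (cone_dim tau).+1 = cone_dim rho'.
  have fX : free (b :: vbasis (lspan tau)).
    by rewrite free_cons (span_basis (vbasisP _)) bT (basis_free (vbasisP _)).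
  rewrite /cone_dim rho'E -[X in (_ + X)%VS](span_basis (vbasisP (lspan tau))) -span_cons.
  by rewrite (eqnP fX) /= (size_basis_of (vbasisP _)).
exists rho', a, b; split=> //.
- by split; [exists m'|rewrite -dr'; case: ft => _ ->; case: fr].
- split=> //; exists l; split=> [v [sv _]|]; first exact: l0.
  apply/seteqP; split=> v /= => [tv|[[sv mv] lv]]; last by apply/tE'.
  by split; [exact: tr'|case/(tE' _ (ts _ tv)): tv].
move=> rho'' fr'' ft''; have [f [rE'' f0 _ _]] := facet_functional fr''.
have ft0 v : tau v -> f v = 0.
  by move=> tv; have := face_sub (proj1 ft'') tv; rewrite rE'' => -[].
have fE := T0 f ft0.
(* The four cases: [f] vanishes on all of [sigma]; [f] is a multiple of [l], giving [rho]; a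
   multiple of [m'], giving [rho']; or a positive combination of both, which cuts out only [tau].
   The first and last contradict that [rho''] is a facet containing [tau] as a facet. *)
have [fa|fa] := eqVneq (f a) 0; have [fb|fb] := eqVneq (f b) 0.
- have [v sv []] := facet_neq fr''.
  by rewrite rE'' /= fE // fa fb !mulr0 addr0.
- left; rewrite rE'' rE; apply/seteqP; split=> v [sv].
    rewrite fE // fa mulr0 addr0 => /eqP.
    by rewrite !mulf_eq0 invr_eq0 (negPf fb) (gt_eqF lb) !orbF => /eqP.
  by move=> lv; split=> //; rewrite fE // lv fa !mul0r mulr0 addr0.
- right; rewrite rE''; apply/seteqP; split=> v [sv].
    rewrite fE // fb mulr0 add0r => /eqP.
    by rewrite !mulf_eq0 invr_eq0 (negPf fa) (gt_eqF m'a) !orbF => /eqP.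
  by move=> lv; split=> //; rewrite fE // lv fb !mul0r mulr0 addr0.
have [v] := facet_neq ft''; rewrite rE'' => -[sv fv] []; apply/tE' => //.
have pa : 0 < f a by rewrite lt0r fa f0.
have pb : 0 < f b by rewrite lt0r fb f0.
move: fv; rewrite fE // => /eqP; rewrite paddr_eq0; last first.
- by rewrite mulr_ge0 ?divr_ge0 ?m'0 // ltW.
- by rewrite mulr_ge0 ?divr_ge0 ?l0 // ltW.
rewrite !mulf_eq0 !invr_eq0 (negPf fa) (negPf fb) (gt_eqF lb) (gt_eqF m'a) !orbF.
by move=> /andP[/eqP -> /eqP ->].
Qed.

End Cones.

(** * Incidence signs *)

Section Incidence.
Variables (R : realType) (V : vectType R).
Implicit Types (rho sigma tau : set V) (X : seq V) (o : set (seq V)).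

Definition orientation_sign o o' : rat := if `[< o = o' >] then 1 else -1.

(** This is [eta] with the two orientations as parameters, so that it also applies to cones without
    a chosen orientation. *)
Definition incidence o o' rho sigma : rat :=
  orientation_sign o (induced_orientation sigma o' rho).

Lemma incidenceE rho sigma o o' X v : pointed_cone sigma -> is_facet rho sigma ->
  is_orientation (lspan rho) o -> is_orientation (lspan sigma) o' ->
  basis_of (lspan rho) X -> sigma v -> ~ rho v ->
  incidence o o' rho sigma = basis_sign o X * basis_sign o' (rcons X v).
Proof.
move=> ps fr oR oS bX sv nrv; have ex := pointed_cone_ray ps fr.
rewrite /incidence /orientation_sign.
rewrite (orientation_asbool_eq oR (induced_orientationP fr oS ex) bX).
congr (_ * _); congr (if _ then _ else _).
exact/asbool_equiv_eq/(induced_orientationE fr oS ex).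
Qed.

Lemma orientation_signE U o o' X : is_orientation U o -> is_orientation U o' ->
  basis_of U X -> orientation_sign o o' = basis_sign o X * basis_sign o' X.
Proof. exact: orientation_asbool_eq. Qed.

Lemma orientation_sign_sqr o o' : orientation_sign o o' * orientation_sign o o' = 1.
Proof. by rewrite /orientation_sign; case: ifP; rewrite ?mulrNN mulr1. Qed.

(** Evaluated on a basis of the facet and its extension, both sides reduce to the sign of [o1] times
    the sign of [o2'], since the other signs occur squared. *)
Lemma incidence_change rho sigma o1 o2 o1' o2' :
  pointed_cone sigma -> is_facet rho sigma ->
  is_orientation (lspan rho) o1 -> is_orientation (lspan rho) o2 ->
  is_orientation (lspan sigma) o1' -> is_orientation (lspan sigma) o2' ->
  incidence o1 o1' rho sigma * orientation_sign o1' o2' =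
  incidence o2 o2' rho sigma * orientation_sign o1 o2.
Proof.
move=> ps fr oR1 oR2 oS1 oS2; have [v sv nrv] := facet_neq fr.
have bX := vbasisP (lspan rho).
rewrite !(incidenceE ps fr _ _ bX sv nrv) //.
rewrite (orientation_signE oR1 oR2 bX).
rewrite (orientation_signE oS1 oS2 (facet_basis_rcons fr bX sv nrv)).
set X := vbasis _ : seq V; set x := basis_sign o1 X; set y := basis_sign o2 X.
have := basis_sign_sqr o2 X; rewrite -/y => yy.
have := basis_sign_sqr o1' (rcons X v); set z := basis_sign o1' _ => zz.
set w := basis_sign o2' _.
have -> : x * z * (z * w) = x * w * (z * z) by ring.
have -> : y * w * (x * y) = x * w * (y * y) by ring.
by rewrite zz yy.
Qed.

(** The paths through [rho] and [rho'] extend a basis of [tau] by [a, b] and by [b, a]. The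
    orientations of the two middle cones enter squared, leaving the sign of the swap. *)
Lemma incidence_diamond tau rho rho' sigma a b oT oR oR' oS :
  pointed_cone rho -> pointed_cone rho' -> pointed_cone sigma ->
  is_facet rho sigma -> is_facet rho' sigma -> is_facet tau rho -> is_facet tau rho' ->
  is_orientation (lspan tau) oT -> is_orientation (lspan rho) oR ->
  is_orientation (lspan rho') oR' -> is_orientation (lspan sigma) oS ->
  [/\ rho a, ~ rho' a & ~ tau a] -> [/\ rho' b, ~ rho b & ~ tau b] ->
  incidence oT oR tau rho * incidence oR oS rho sigma +
  incidence oT oR' tau rho' * incidence oR' oS rho' sigma = 0.
Proof.
move=> pr pr' ps fr fr' ft ft' hT hR hR' hS [ra nra nta] [rb nrb ntb].
have sa := face_sub (proj1 fr) ra; have sb := face_sub (proj1 fr') rb.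
have bX := vbasisP (lspan tau); set X := vbasis _ : seq V in bX.
have bXa := facet_basis_rcons ft bX ra nta.
have bXb := facet_basis_rcons ft' bX rb ntb.
rewrite (incidenceE pr ft hT hR bX ra nta) (incidenceE pr' ft' hT hR' bX rb ntb).
rewrite (incidenceE ps fr hR hS bXa sb nrb) (incidenceE ps fr' hR' hS bXb sa nra).
have bXab := facet_basis_rcons fr bXa sb nrb.
have bXba := facet_basis_rcons fr' bXb sa nra.
rewrite (basis_sign_orientation hS bXab bXba).
rewrite (basis_change_det_swap (basis_free bXab)) ltr0N1 mulN1r.
have := basis_sign_sqr oR (rcons X a); have := basis_sign_sqr oR' (rcons X b).
set p := basis_sign oR _; set q := basis_sign oR' _ => qq pp.
set x := basis_sign oT _; set y := basis_sign oS _.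
have -> : x * p * (p * y) + x * q * (q * - y) = x * y * (p * p - q * q) by ring.
by rewrite pp qq subrr mulr0.
Qed.

End Incidence.

(** * Transport of faces, facets and incidence signs along a linear map with a left inverse *)

Section ConeTransport.
Variables (R : realType) (V W : vectType R).
Variables (f : {linear V -> W}) (f' : {linear W -> V}).
Hypothesis fK : cancel f f'.
Implicit Types (rho sigma : set V) (X : seq V) (o : set (seq V)).

Lemma image_conic_hull (S : set V) : f @` conic_hull S = conic_hull (f @` S).
Proof.
apply/seteqP; split=> [_ [_ [n [s [c [Ss c0 ->]]]] <-]|].
  exists n, (f \o s), c; split=> // [i|]; first by exists (s i).
  by rewrite linear_sum; apply: eq_bigr => i _; rewrite linearZ.
apply: conic_hull_ind => [|_ _ [v vS <-] [w wS <-]|c _ [v vS <-] c0].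
- by exists 0; [exact: conic_hull0|exact: linear0].
- by exists (v + w); [exact: conic_hullD|exact: linearD].
- by exists (c *: v); [apply: conic_hullZ => //; exact: conic_hull_sub|exact: linearZ].
Qed.

Lemma lspan_image sigma : lspan (f @` sigma) = (linfun f @: lspan sigma)%VS.
Proof.
apply: lspan_unique; split=> [_ [v sv <-]|U fU].
  by rewrite (mem_map_space fK); exact: lspan_mem.
have /subvP sU : (lspan sigma <= linfun f @^-1: U)%VS.
  by apply: lspan_sub => v sv; rewrite -memv_preim lfunE; apply: fU; exists v.
by apply/subvP => _ /memv_imgP[v /sU + ->]; rewrite -memv_preim.
Qed.

Lemma cone_dim_image sigma : cone_dim (f @` sigma) = cone_dim sigma.
Proof. by rewrite /cone_dim lspan_image (dim_map_space fK). Qed.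

Lemma image_cone_inj rho sigma : f @` rho = f @` sigma -> rho = sigma.
Proof.
have cancel_image C : f' @` (f @` C) = C.
  apply/seteqP; split=> [_ [_ [v Cv <-] <-]|v Cv]; first by rewrite fK.
  by exists (f v); [exists v|rewrite fK].
by move=> /(congr1 (fun C => f' @` C)); rewrite !cancel_image.
Qed.

Lemma mem_image_cone sigma v : (f @` sigma) (f v) <-> sigma v.
Proof. by split=> [[w sw /(can_inj fK) <-]|sv] //; exists v. Qed.

(** A supporting functional is carried to the target by composing it with the left inverse [f']. *)
Lemma face_image rho sigma : is_face rho sigma -> is_face (f @` rho) (f @` sigma).
Proof.
move=> [l [l0 ->]]; have [m mE] : exists m : {scalar W}, m =1 (fun w => l (f' w)).
  by apply: scalar_exists => k v w; rewrite !linearP.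
exists m; split=> [_ [v sv <-]|]; first by rewrite mE fK; exact: l0.
apply/seteqP; split=> [_ [v [sv lv] <-]|_ [[v sv <-]]] /=.
  by split; [exists v|rewrite mE fK].
by rewrite mE fK => lv; exists v.
Qed.

Lemma face_imageP (rho' : set W) sigma : is_face rho' (f @` sigma) ->
  exists2 rho, is_face rho sigma & rho' = f @` rho.
Proof.
move=> [m [m0 ->]]; have [l lE] : exists l : {scalar V}, l =1 (fun v => m (f v)).
  by apply: scalar_exists => k v w; rewrite !linearP.
exists [set v | sigma v /\ l v = 0].
  by exists l; split=> // v sv; rewrite lE; apply: m0; exists v.
apply/seteqP; split=> [_ [[v sv <-]] mv|_ [v [sv lv] <-]] /=.
  by exists v => //; split=> //; rewrite lE.
by split; [exists v|rewrite -lE].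
Qed.

Lemma facet_image rho sigma : is_facet rho sigma -> is_facet (f @` rho) (f @` sigma).
Proof. by move=> [fr dr]; split; [exact: face_image|rewrite !cone_dim_image]. Qed.

Lemma facet_imageP (rho' : set W) sigma : is_facet rho' (f @` sigma) ->
  exists2 rho, is_facet rho sigma & rho' = f @` rho.
Proof.
move=> [/face_imageP[rho fr ->]]; rewrite !cone_dim_image => dr.
by exists rho.
Qed.

Lemma pointed_cone_image sigma : pointed_cone sigma -> pointed_cone (f @` sigma).
Proof.
move=> [S -> gS]; exists (map f S) => [|_ /mapP[v /gS [v0 [rho [fr dr rv]]] ->]].
  rewrite image_conic_hull; congr conic_hull; apply/seteqP; split=> w /=.
    by move=> [v vS <-]; exact: map_f.
  by move=> /mapP[v vS ->]; exists v.
split; first by rewrite -(linear0 f) (inj_eq (can_inj fK)).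
exists (f @` rho); split; [exact: face_image|by rewrite cone_dim_image|by exists v].
Qed.

Lemma perm_facets_image sigma : pointed_cone sigma ->
  perm_eq (facets (f @` sigma)) [seq f @` rho | rho <- facets sigma].
Proof.
move=> ps; apply: uniq_perm; first exact: facets_uniq.
  by rewrite map_inj_uniq ?facets_uniq //; exact: image_cone_inj.
move=> rho; apply/(facetsP _ (pointed_cone_image ps))/mapP.
  by move=> /facet_imageP[rho' fr ->]; exists rho' => //; apply/facetsP.
by move=> [rho' /(facetsP _ ps) fr ->]; exact: facet_image.
Qed.

Lemma orientation_image sigma o : is_orientation (lspan sigma) o ->
  is_orientation (lspan (f @` sigma)) (map f @` o).
Proof. by move=> hS; rewrite lspan_image; exact: orientation_map fK _ _ hS. Qed.

Lemma orientation_sign_image sigma o o' : is_orientation (lspan sigma) o ->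
  is_orientation (lspan sigma) o' ->
  orientation_sign (map f @` o) (map f @` o') = orientation_sign o o'.
Proof.
move=> h h'; have bX := vbasisP (lspan sigma).
have fX : basis_of (lspan (f @` sigma)) (map f (vbasis (lspan sigma))).
  by rewrite lspan_image; exact: basis_of_map fK _ _ bX.
rewrite (orientation_signE h h' bX).
rewrite (orientation_signE (orientation_image h) (orientation_image h') fX).
by rewrite !(basis_sign_map fK).
Qed.

Lemma incidence_image rho sigma o o' : pointed_cone sigma -> is_facet rho sigma ->
  is_orientation (lspan rho) o -> is_orientation (lspan sigma) o' ->
  incidence (map f @` o) (map f @` o') (f @` rho) (f @` sigma) =
  incidence o o' rho sigma.
Proof.
move=> ps fr hR hS; have [v sv nrv] := facet_neq fr.
have bX := vbasisP (lspan rho).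
have fX : basis_of (lspan (f @` rho)) (map f (vbasis (lspan rho))).
  by rewrite lspan_image; exact: basis_of_map fK _ _ bX.
rewrite (incidenceE ps fr hR hS bX sv nrv).
rewrite (incidenceE (pointed_cone_image ps) (facet_image fr) (orientation_image hR)
  (orientation_image hS) fX (proj2 (mem_image_cone _ _) sv)); last first.
  by move=> /mem_image_cone.
by rewrite -map_rcons !(basis_sign_map fK).
Qed.

End ConeTransport.

(** * Minimal vectors and perfect cones *)

Section QuadraticForms.
Variables (R : realType) (g : nat).
Local Notation form := 'M[R]_g.
Implicit Types (Q N : form) (x y : 'cV[R]_g).

Definition bform Q x y : R := (x^T *m Q *m y) 0 0.

Lemma qform_bform Q x : qform Q x = bform Q x x. Proof. by []. Qed.

Lemma qform0 Q : qform Q 0 = 0. Proof. by rewrite /qform mulmx0 mxE. Qed.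

Lemma bformC Q x y : Q^T = Q -> bform Q x y = bform Q y x.
Proof.
move=> sQ; rewrite /bform -[in LHS](trmxK (_ *m y)) [LHS]mxE.
by rewrite !trmx_mul trmxK sQ mulmxA.
Qed.

Lemma bformDl Q x x' y : bform Q (x + x') y = bform Q x y + bform Q x' y.
Proof. by rewrite /bform linearD !mulmxDl mxE. Qed.

Lemma bformDr Q x y y' : bform Q x (y + y') = bform Q x y + bform Q x y'.
Proof. by rewrite /bform mulmxDr mxE. Qed.

Lemma bformZl Q a x y : bform Q (a *: x) y = a * bform Q x y.
Proof. by rewrite /bform linearZ -!scalemxAl mxE. Qed.

Lemma bformZr Q a x y : bform Q x (a *: y) = a * bform Q x y.
Proof. by rewrite /bform -scalemxAr mxE. Qed.

(** Stated as an identity so that it serves twice: positivity of the left side gives the inequality,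
    and its vanishing forces proportionality. *)
Lemma qform_Cauchy_Schwarz Q x y : Q^T = Q ->
  qform Q (qform Q y *: x - bform Q x y *: y) =
  qform Q y * (qform Q x * qform Q y - bform Q x y ^+ 2).
Proof.
move=> sQ; rewrite !qform_bform -scaleNr bformDl !bformDr !bformZl !bformZr.
by rewrite (bformC y x sQ); ring.
Qed.

Lemma Omega_ge0 Q x : Omega Q -> 0 <= qform Q x.
Proof.
move=> [_ pQ]; have [->|/pQ/ltW//] := eqVneq x 0.
by rewrite qform0.
Qed.

Lemma Cauchy_Schwarz Q x y : Omega Q ->
  bform Q x y ^+ 2 <= qform Q x * qform Q y.
Proof.
move=> oQ; have [->|y0] := eqVneq y 0.
  by rewrite /qform /bform !mulmx0 mxE mulr0 expr0n.
rewrite -subr_ge0 -(pmulr_rge0 _ (proj2 oQ y y0)) -qform_Cauchy_Schwarz ?(proj1 oQ) //.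
exact: Omega_ge0.
Qed.

Lemma Omega_unitmx Q : Omega Q -> Q \in unitmx.
Proof.
move=> [sQ pQ]; rewrite -row_free_unit -kermx_eq0; apply/rowV0P => v /sub_kermxP vQ.
apply: trmx_inj; rewrite trmx0; apply/eqP; apply: contraT => /pQ.
by rewrite /qform trmxK vQ mul0mx mxE ltxx.
Qed.

(** The [i]-th coordinate is the pairing of [x] under [Q] with [invmx Q] applied to the [i]-th basis
    vector, so Cauchy-Schwarz bounds it; [C] is the trace of the inverse of [Q]. This stands in for
    compactness of the sphere. *)
Lemma Omega_coord_bound Q : Omega Q ->
  exists2 C, 0 <= C & forall x i, x i 0 ^+ 2 <= C * qform Q x.
Proof.
move=> oQ; pose e i : 'cV[R]_g := invmx Q *m delta_mx i 0.
have e0 i : 0 <= qform Q (e i) by exact: Omega_ge0.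
exists (\sum_i qform Q (e i)) => [|x i]; first by apply: sumr_ge0.
have -> : x i 0 = bform Q x (e i).
  rewrite /bform /e -mulmxA (mulmxA Q) mulmxV ?Omega_unitmx // mul1mx.
  by rewrite -colE !mxE.
apply: le_trans (Cauchy_Schwarz _ _ oQ) _; rewrite mulrC ler_wpM2r ?Omega_ge0 //.
by rewrite (bigD1 i) //= lerDl sumr_ge0.
Qed.

End QuadraticForms.

(** * Finiteness of minimal vectors, and extremality of the rays they generate *)

Section PerfectConeGeneration.
Variables (R : realType) (g : nat).
Local Notation form := 'M[R]_g.
Implicit Types (Q : form) (x y : 'cV[int]_g).

Lemma Omega_finite Q c : Omega Q ->
  exists s : seq 'cV[int]_g, forall x : 'cV[int]_g, qform Q (intcv R x) <= c -> x \in s.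
Proof.
move=> oQ; have [C C0 CP] := Omega_coord_bound oQ.
(* An integer whose square is at most [N] is itself at most [N] in absolute value, so the box of
   coordinates from [-N] to [N] suffices. *)
pose N := Num.truncn (C * c); pose f (k : 'I_(N.*2.+1)) : int := k%:Z - N%:Z.
exists [seq map_mx f z | z : 'cV_g] => x xc.
have xN i : (`|x i 0%R| <= N)%N.
  have qC : (`|x i 0| ^ 2)%:R <= C * c.
    apply: le_trans (ler_wpM2l C0 xc); apply: le_trans (CP _ i).
    by rewrite mxE natrX natr_absz intr_norm real_normK ?num_real.
  have : (`|x i 0%R| ^ 2 < N.+1)%N.
    by rewrite -(ltr_nat R); apply: le_lt_trans qC _; exact: truncnS_gt.
  by rewrite ltnS; apply: leq_trans; case: absz => // n; rewrite expnS leq_pmulr.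
apply/mapP; exists (map_mx (fun k : int => inord (absz (k + N%:Z))) x); rewrite ?mem_enum //.
apply/matrixP => i j; rewrite !mxE /f ord1 inordK; last by have := xN i; lia.
have := xN i; move: (x i _) => k; clear; lia.
Qed.

Lemma min_vectors_seq Q : Omega Q ->
  exists s : seq 'cV[int]_g, min_vectors Q = [set` s].
Proof.
move=> oQ; have [[x0 mx0]|none] := pselect (exists x, min_vectors Q x); last first.
  by exists [::]; apply/seteqP; split=> x //= mx; case: none; exists x.
have [s sP] := Omega_finite (qform Q (intcv R x0)) oQ.
exists (seq.filter (fun x => `[< min_vectors Q x >]) s).
apply/seteqP; split=> x /=; rewrite mem_filter; last by move=> /andP[/asboolP].
move=> mx; rewrite sP ?andbT; first exact/asboolP.
by case: mx => _; apply; case: mx0.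
Qed.

(** The vector [x] excludes the zero lattice, which has no minimal vectors, and reduces the search
    to the finitely many vectors of value at most that of [x]. *)
Lemma min_vectors_neq0 Q x : Omega Q -> x != 0 -> exists y, min_vectors Q y.
Proof.
move=> oQ x0; have [s sP] := Omega_finite (qform Q (intcv R x)) oQ.
have /(seq_argmin (fun y => qform Q (intcv R y)))[b [_ b0] bmin] :
    has (fun y : 'cV[int]_g => y != 0) s.
  by apply/hasP; exists x; rewrite ?sP.
exists b; split=> // y y0.
have [/sP ys|/ltW xy] := lerP (qform Q (intcv R y)) (qform Q (intcv R x)).
  exact: bmin.
by apply: le_trans (bmin x (sP _ _) x0) xy.
Qed.

Definition rank1 (x : 'cV[int]_g) : form := intcv R x *m (intcv R x)^T.

Lemma intcv_eq0 (x : 'cV[int]_g) : (intcv R x == 0) = (x == 0).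
Proof.
apply/eqP/eqP => [/matrixP x0|->]; last exact: map_mx0.
by apply/matrixP => i j; have /eqP := x0 i j; rewrite !mxE intr_eq0 => /eqP.
Qed.

Lemma perfect_cone_seq sigma : @perfect_cone R g sigma ->
  exists2 s : seq 'cV[int]_g, forall x, x \in s -> x != 0 &
    sigma = conic_hull [set` map rank1 s].
Proof.
move=> [->|[Q oQ ->]].
  exists [::] => //; apply/seteqP; split=> [v /= ->|]; first exact: conic_hull0.
  by apply: conic_hull_ind => //= v w -> ->; rewrite addr0.
have [s sE] := min_vectors_seq oQ.
exists s => [x xs|]; first by have [] : min_vectors Q x by rewrite sE.
rewrite /sigma_cone sE; congr conic_hull; apply/seteqP; split=> v /=.
  by move=> [x xs <-]; exact: map_f.
by move=> /mapP[x xs ->]; exists x.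
Qed.

Lemma Omega1 : @Omega R g 1%:M.
Proof.
have qE (x : 'cV[R]_g) : qform 1%:M x = \sum_i x i 0 ^+ 2.
  by rewrite /qform mulmx1 mxE; apply: eq_bigr => i _; rewrite mxE expr2.
split=> [|x x0]; first exact: trmx1.
rewrite qE lt0r sumr_ge0 ?andbT => [|i _]; last exact: sqr_ge0.
apply: contra x0 => /eqP s0; apply/eqP/colP => i; rewrite mxE.
have /(_ i isT)/eqP := psumr_eq0P (fun i _ => sqr_ge0 (x i 0)) s0.
by rewrite sqrf_eq0 => /eqP.
Qed.

(* [|x|^2 tr A - x^T A x] is nonnegative on rank one forms [y y^T] by
   Cauchy-Schwarz, and vanishes only if [y] is proportional to [x]. *)
Lemma rank1_ray_generator (s : seq 'cV[int]_g) x : (forall x, x \in s -> x != 0) ->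
  x \in s -> ray_generator (conic_hull [set` map rank1 s]) (rank1 x).
Proof.
move=> s0 xs; set C := conic_hull _.
have x0 : intcv R x != 0 by rewrite intcv_eq0 s0.
have qx : qform 1%:M (intcv R x) != 0 by rewrite gt_eqF // (proj2 Omega1).
have trE y : \tr (rank1 y) = qform 1%:M (intcv R y).
  by rewrite /rank1 mxtrace_mulC trace_mx11 /qform mulmx1.
have rank1_neq0 : rank1 x != 0.
  by apply/eqP => r0; move: qx; rewrite -trE r0 mxtrace0 eqxx.
split=> //.
have [l lE] : exists l : {scalar form},
    l =1 (fun A => qform 1%:M (intcv R x) * \tr A - qform A (intcv R x)).
  apply: scalar_exists => k v w /=; rewrite linearP /= /qform mulmxDr mulmxDl.
  by rewrite -scalemxAr -scalemxAl !mxE; ring.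
have lrank1 y : l (rank1 y) = qform 1%:M (intcv R x) * qform 1%:M (intcv R y)
    - bform 1%:M (intcv R x) (intcv R y) ^+ 2.
  rewrite lE trE; congr (_ - _); rewrite /qform /rank1 !mulmxA -mulmxA mxE big_ord1.
  by rewrite expr2 {2}bformC ?trmx1 // /bform !mulmx1.
have l0 v : C v -> 0 <= l v.
  move: v; apply: conic_hull_ind => [|u w lu lw|c _ /= /mapP[y _ ->] c0].
    by rewrite linear0.
    by rewrite linearD addr_ge0.
  rewrite linearZ mulr_ge0 //= lrank1 subr_ge0; exact: Cauchy_Schwarz Omega1.
exists [set v | C v /\ l v = 0]; split; first by exists l.
  rewrite /cone_dim face_conic_hull // lspan_conic_hull.
  suff -> : (<<seq.filter (fun v => l v == 0%R) (map rank1 s)>> = <[rank1 x]>)%VS.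
    by rewrite dim_vline rank1_neq0.
  apply/subv_anti/andP; split; last first.
    rewrite -memvE; apply: memv_span; rewrite mem_filter map_f // andbT.
    by rewrite lrank1 expr2 subrr.
  apply/span_subvP => v; rewrite mem_filter => /andP[+ /mapP[y _ vE]]; rewrite vE lrank1.
  move=> /eqP l_y; have /eqP : qform 1%:M (qform 1%:M (intcv R x) *: intcv R y -
      bform 1%:M (intcv R y) (intcv R x) *: intcv R x) = 0.
    rewrite qform_Cauchy_Schwarz ?trmx1 // (bformC (intcv R y)) ?trmx1 //.
    by rewrite [X in X - _]mulrC l_y mulr0.
  have [/eqP|nz] := eqVneq (qform 1%:M (intcv R x) *: intcv R y -
    bform 1%:M (intcv R y) (intcv R x) *: intcv R x) 0; last first.
    by rewrite (gt_eqF (proj2 Omega1 _ nz)).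
  rewrite subr_eq0 => /eqP yE _.
  apply/vlineP; set k := bform _ _ _ in yE; exists ((k / qform 1%:M (intcv R x)) ^+ 2).
  have {}yE : intcv R y = (k / qform 1%:M (intcv R x)) *: intcv R x.
    by rewrite mulrC -scalerA -yE scalerA mulVf // scale1r.
  by rewrite /rank1 yE linearZ /= -scalemxAl -scalemxAr scalerA expr2.
split; first by apply: conic_hull_sub; exact: map_f.
by rewrite lrank1 -/(qform _ _) expr2 subrr.
Qed.

Lemma perfect_pointed sigma : @perfect_cone R g sigma -> pointed_cone sigma.
Proof.
move=> /perfect_cone_seq[s s0 ->]; exists (map rank1 s) => // _ /mapP[x xs ->].
exact: rank1_ray_generator.
Qed.

End PerfectConeGeneration.

(** * Integer matrices with the same row lattice *)

Section SmithNormalForm.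
Variable F : realFieldType.

Lemma intmx_inj m n : injective (map_mx (intr : int -> F) : 'M_(m, n) -> 'M_(m, n)).
Proof.
move=> A B /matrixP AB; apply/matrixP => i j.
by have := AB i j; rewrite !mxE => /intr_inj.
Qed.

(* [L *m pid_mx r *m invmx L] projects onto the saturation of the column
   lattice of [X]. *)
Lemma saturation m n (X : 'M[int]_(m, n)) : exists (L : 'M[int]_m) r,
  [/\ L \in unitmx, (r <= m)%N, pid_mx r *m (invmx L *m X) = invmx L *m X &
   forall k (u : 'M[F]_(k, m)), u *m map_mx intr X = 0 ->
     u *m map_mx intr L *m (pid_mx r : 'M_m) = 0].
Proof.
have [L uL [P uP [d sd XE]]] := int_Smith_normal_form X.
set D := \matrix_(i, j) _ in XE.
(* The number of nonzero invariant factors: by the divisibility chain, all entries after the first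
   zero vanish. The bounds [m] and [n] are imposed because the list [d] may be longer than the
   diagonal. *)
pose r := minn (minn m n) (seq.find (pred1 (0 : int)) d).
have d0 i : (seq.find (pred1 (0 : int)) d <= i)%N -> d`_i = 0.
  have [di ki|di] := ltnP i (size d); last by rewrite nth_default.
  have kd := leq_ltn_trans ki di; have := nth_find 0 (_ : has (pred1 (0 : int)) d).
  rewrite has_find kd => /(_ isT)/= /eqP dk.
  have : (d`_(seq.find (pred1 (0 : int)) d) %| d`_i)%Z.
    exact: (@sorted_leq_nth _ dvdz dvdz_trans dvdzz 0 d sd _ _ kd di ki).
  by rewrite dk dvd0z => /eqP.
have rD : invmx L *m X = D *m P by rewrite XE -mulmxA mulKmx.
have [rm rn rk] : [/\ (r <= m)%N, (r <= n)%N & (r <= seq.find (pred1 (0 : int)) d)%N].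
  by rewrite /r !geq_min !leqnn !orbT /=; split=> //; rewrite !geq_min leqnn ?orbT.
exists L, r; split=> //.
  rewrite rD mulmxA; congr (_ *m P); apply/matrixP => i j; rewrite !mxE.
  rewrite (bigD1 i) //= big1 ?addr0 => [|k ki]; last first.
    by rewrite mxE val_eqE eq_sym (negPf ki) mul0r.
  rewrite mxE eqxx /=; case: ltnP => ri; first by rewrite mul1r mxE.
  rewrite mul0r; case: eqP => // ij; rewrite mulr1n d0 //.
  by move: ri; rewrite /r !geq_min (leqNgt m) ltn_ord ij (leqNgt n) ltn_ord.
move=> k u uX; have {}uX : u *m map_mx intr L *m map_mx intr D = 0.
  have /(congr1 (mulmx^~ (map_mx intr (invmx P)))) := uX.
  by rewrite XE !map_mxM mul0mx -!mulmxA -map_mxM mulmxV // map_mx1 mulmx1.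
move: uX; move: (u *m _) => v /matrixP vD; apply/matrixP => a j; rewrite !mxE.
rewrite (bigD1 j) //= big1 ?addr0 => [|i ij]; last by rewrite mxE val_eqE (negPf ij) mulr0.
rewrite mxE eqxx /=; case: ltnP => jr; last by rewrite mulr0.
have jn := leq_trans jr rn.
have := vD a (Ordinal jn); rewrite !mxE (bigD1 j) //= big1 ?addr0 => [|i ij]; last first.
  by rewrite !mxE /= val_eqE (negPf ij) mulr0.
rewrite !mxE /= eqxx mulr1n mulr1 => /eqP; rewrite mulf_eq0 intr_eq0 => /orP[/eqP //|].
have /(before_find 0) /= : (j < seq.find (pred1 (0 : int)) d)%N by exact: leq_trans rk.
by move=> ->.
Qed.

End SmithNormalForm.

(** [A] and [B] need not be invertible, but cut down by projections they give inverse isomorphisms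
    between the saturations of the column lattices of [X] and [Y]. These have complements of equal
    rank in the lattice of rank [m], so the isomorphism extends. *)
Lemma unimodular_factor m n (X Y : 'M[int]_(m, n)) (A B : 'M[int]_m) :
  Y = A *m X -> X = B *m Y -> exists2 U, U \in unitmx & Y = U *m X.
Proof.
move=> YE XE.
have [L [r [uL rm eX annX]]] := saturation rat X.
have [K [s [uK sm eY annY]]] := saturation rat Y.
have annZ (Z : 'M[int]_(m, n)) (T : 'M_m) t :
    (forall k (u : 'M[rat]_(k, m)), u *m map_mx intr Z = 0 ->
      u *m map_mx intr T *m (pid_mx t : 'M_m) = 0) ->
    forall u : 'M[int]_m, u *m Z = 0 -> u *m T *m (pid_mx t : 'M_m) = 0.
  move=> annT u uZ; apply: (@intmx_inj rat).
  by rewrite !map_mxM map_pid_mx map_mx0 annT // -map_mxM uZ map_mx0.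
have {annX annZ annY}[annX annY] := (annZ X L r annX, annZ Y K s annY).
pose E := L *m (pid_mx r : 'M_m) *m invmx L.
pose G := K *m (pid_mx s : 'M_m) *m invmx K.
have EX : E *m X = X by rewrite /E -!mulmxA eX mulKVmx.
have GY : G *m Y = Y by rewrite /G -!mulmxA eY mulKVmx.
have pidM t : (t <= m)%N -> (pid_mx t : 'M_m) *m (pid_mx t : 'M_m) = pid_mx t :> 'M[int]_m.
  by move=> tm; exact: pid_mx_id.
have EE : E *m E = E by rewrite /E -!mulmxA mulKmx // (mulmxA (pid_mx r)) pidM.
have GG : G *m G = G by rewrite /G -!mulmxA mulKmx // (mulmxA (pid_mx s)) pidM.
have EX0 (T : 'M[int]_m) : T *m X = 0 -> T *m E = 0.
  by move=> /annX h; rewrite /E !mulmxA h mul0mx.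
have GY0 (T : 'M[int]_m) : T *m Y = 0 -> T *m G = 0.
  by move=> /annY h; rewrite /G !mulmxA h mul0mx.
pose A' := G *m A *m E; pose B' := E *m B *m G.
have A'E : A' *m E = A' by rewrite /A' -(mulmxA (G *m A) E E) EE.
have B'G : B' *m G = B' by rewrite /B' -(mulmxA (E *m B) G G) GG.
have A'X : A' *m X = Y by rewrite /A' -mulmxA EX -mulmxA -YE.
have B'Y : B' *m Y = X by rewrite /B' -mulmxA GY -mulmxA -XE.
have BA : B' *m A' = E.
  have : (B' *m A' - 1%:M) *m X = 0 by rewrite mulmxBl mul1mx -mulmxA A'X B'Y subrr.
  by move=> /EX0 /eqP; rewrite mulmxBl mul1mx -(mulmxA B' A' E) A'E subr_eq0 => /eqP.
have AB : A' *m B' = G.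
  have : (A' *m B' - 1%:M) *m Y = 0 by rewrite mulmxBl mul1mx -mulmxA B'Y A'X subrr.
  by move=> /GY0 /eqP; rewrite mulmxBl mul1mx -(mulmxA A' B' G) B'G subr_eq0 => /eqP.
have tr_pid t : (t <= m)%N -> \tr (pid_mx t : 'M[int]_m) = t%:R.
  move=> tm; rewrite /mxtrace -[in RHS](card_ord t) -sumr_const.
  have := @big_ord_narrow int 0 +%R _ _ (fun=> 1) tm; rewrite /= => <-.
  by rewrite [RHS]big_mkcond; apply: eq_bigr => i _; rewrite mxE eqxx /=; case: ltnP.
(* [E] and [G] are the products of [A'] and [B'] in the two orders, so they have equal trace, and
   the trace of each projection is its rank. *)
have rs : r = s.
  have : \tr E = \tr G by rewrite -BA -AB mxtrace_mulC.
  rewrite /E /G mxtrace_mulC mulKmx // [RHS]mxtrace_mulC mulKmx // !tr_pid //.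
  by move=> /eqP; rewrite eqr_nat => /eqP.
subst s; pose c : 'M[int]_m := 1%:M - pid_mx r.
have ce : c *m (pid_mx r : 'M_m) = 0 by rewrite /c mulmxBl mul1mx pidM // subrr.
have ec : (pid_mx r : 'M_m) *m c = 0 by rewrite /c mulmxBr mulmx1 pidM // subrr.
have cc : c *m c = c by rewrite {2}/c mulmxBr mulmx1 ce subr0.
(* [U] acts as [A'] on the saturation for [X] and sends the last columns of [L] to those of [K]; [W]
   does the reverse. *)
pose U := A' + K *m c *m invmx L; pose W := B' + L *m c *m invmx K.
have UX : U *m X = Y.
  rewrite mulmxDl A'X -[X in K *m _ *m _ *m X]EX /E -!mulmxA mulKmx //.
  by rewrite (mulmxA c) ce mul0mx !mulmx0 addr0.
exists U => //; suff /mulmx1_unit[//] : U *m W = 1%:M.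
rewrite /U mulmxDl (mulmxDr A' B') (mulmxDr (K *m c *m invmx L) B') AB.
have -> : A' *m (L *m c *m invmx K) = 0.
  by rewrite /A' /E -!mulmxA mulKmx // (mulmxA (pid_mx r) c) ec mul0mx !mulmx0.
have -> : K *m c *m invmx L *m B' = 0.
  by rewrite /B' /E -!mulmxA mulKmx // (mulmxA c (pid_mx r)) ce mul0mx !mulmx0.
rewrite addr0 add0r -!mulmxA mulKmx // (mulmxA c) cc /G -mulmxA -mulmxDr -mulmxDl.
by rewrite addrC subrK mul1mx mulmxV.
Qed.

(** * Congruence action of integer matrices *)

Section Congruence.
Variable R : realType.

Definition congr_act (p q : nat) (A : 'M[int]_(p, q)) (Q : 'M[R]_q) : 'M[R]_p :=
  map_mx intr A *m Q *m (map_mx intr A)^T.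

Lemma congr_act_is_linear p q (A : 'M[int]_(p, q)) : linear (congr_act A).
Proof.
by move=> k Q Q'; rewrite /congr_act mulmxDr mulmxDl -scalemxAr -scalemxAl.
Qed.

HB.instance Definition _ p q (A : 'M[int]_(p, q)) :=
  GRing.isLinear.Build R 'M[R]_q 'M[R]_p *:%R (congr_act A) (congr_act_is_linear A).

Lemma congr_act_mul p q r (A : 'M[int]_(p, q)) (B : 'M[int]_(q, r)) Q :
  congr_act (A *m B) Q = congr_act A (congr_act B Q).
Proof. by rewrite /congr_act map_mxM trmx_mul !mulmxA. Qed.

Lemma congr_act1 p (Q : 'M[R]_p) : congr_act 1%:M Q = Q.
Proof. by rewrite /congr_act map_mx1 trmx1 mul1mx mulmx1. Qed.

Lemma congr_actK p q (A : 'M[int]_(p, q)) B : B *m A = 1%:M ->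
  cancel (congr_act A) (congr_act B).
Proof. by move=> BA Q; rewrite -congr_act_mul BA congr_act1. Qed.

Lemma image_congr_act_mul p q r (A : 'M[int]_(p, q)) (B : 'M[int]_(q, r))
    (C : set 'M[R]_r) :
  congr_act (A *m B) @` C = congr_act A @` (congr_act B @` C).
Proof.
by rewrite image_comp; congr image; apply/funext => Q; rewrite /= congr_act_mul.
Qed.

Lemma image_congr_act1 p (C : set 'M[R]_p) : congr_act 1%:M @` C = C.
Proof.
by rewrite (_ : congr_act 1%:M = id) ?image_id //; apply/funext => Q; exact: congr_act1.
Qed.

Lemma congr_act_sym p q (A : 'M[int]_(p, q)) (Q : 'M[R]_q) :
  Q^T = Q -> (congr_act A Q)^T = congr_act A Q.
Proof. by move=> sQ; rewrite /congr_act !trmx_mul trmxK sQ mulmxA. Qed.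

Lemma intcvM p q (A : 'M[int]_(p, q)) x : intcv R (A *m x) = map_mx intr A *m intcv R x.
Proof. exact: map_mxM. Qed.

Lemma congr_act_rank1 p q (A : 'M[int]_(p, q)) x :
  congr_act A (rank1 R x) = rank1 R (A *m x).
Proof. by rewrite /congr_act /rank1 intcvM trmx_mul !mulmxA. Qed.

Lemma qform_congr_act p q (A : 'M[int]_(p, q)) Q x :
  qform (congr_act A^T Q) x = qform Q (map_mx intr A *m x).
Proof. by rewrite /qform /congr_act trmx_mul -map_trmx trmxK !mulmxA. Qed.

Lemma Omega_pull p q (A : 'M[int]_(p, q)) B (Q : 'M[R]_p) : B *m A = 1%:M ->
  Omega Q -> Omega (congr_act A^T Q).
Proof.
move=> BA [sQ pQ]; split=> [|x x0]; first exact: congr_act_sym.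
rewrite qform_congr_act; apply: pQ; apply: contra_neq x0 => Ax0.
by rewrite -[x]mul1mx -(map_mx1 (intr : int -> R)) -BA map_mxM -mulmxA Ax0 mulmx0.
Qed.

Lemma mul_cancel_neq0 p q (A : 'M[int]_(p, q)) B (x : 'cV[int]_q) : B *m A = 1%:M ->
  x != 0 -> A *m x != 0.
Proof.
move=> BA; apply: contra_neq => Ax0.
by rewrite -[x]mul1mx -BA -mulmxA Ax0 mulmx0.
Qed.

Lemma rank1_eq0 p (x : 'cV[int]_p) : rank1 R x = 0 -> x = 0.
Proof.
move=> /matrixP x0; apply/colP => i; have /eqP := x0 i i.
by rewrite /rank1 mxE big_ord1 !mxE mulf_eq0 orbb intr_eq0 => /eqP.
Qed.

Lemma qform1_int_ge1 p (x : 'cV[int]_p) : x != 0 -> 1 <= qform 1%:M (intcv R x).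
Proof.
move=> x0; have qE : qform 1%:M (intcv R x) = (\sum_i x i 0 ^+ 2)%:~R.
  rewrite /qform mulmx1 mxE rmorph_sum; apply: eq_bigr => i _.
  by rewrite !mxE expr2 rmorphM.
have := proj2 (@Omega1 R p) (intcv R x); rewrite intcv_eq0 => /(_ x0).
by rewrite qE ltr0z -[1](_ : 1%:~R = _) // ler_int -gtz0_ge1.
Qed.

Lemma conic_hull_set0 (V : vectType R) : conic_hull (set0 : set V) = [set 0].
Proof.
apply/seteqP; split=> [|_ ->]; last exact: conic_hull0.
by apply: conic_hull_ind => //= v w -> ->; rewrite addr0.
Qed.

(* For [B *m A = 1%:M], the minimal vectors of
   [B^T Q B + (m + 1) (1 - A B)^T (1 - A B)], where [m] is the minimum of [Q],
   are the images under [A] of those of [Q]. *)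
Lemma perfect_cone_image p q (A : 'M[int]_(p, q)) B sigma : B *m A = 1%:M ->
  perfect_cone sigma -> perfect_cone (congr_act A @` sigma).
Proof.
move=> BA [->|[Q oQ ->]]; first by left; rewrite image_set1 linear0.
rewrite /sigma_cone image_conic_hull image_comp.
have [[x0 mx0]|none] := pselect (exists x, min_vectors Q x); last first.
  left; rewrite (_ : min_vectors Q = set0) ?image_set0 ?conic_hull_set0 //.
  by apply/seteqP; split=> x // mx; case: none; exists x.
pose m := qform Q (intcv R x0); pose Z := 1%:M - A *m B.
have m0 : 0 <= m by exact: Omega_ge0.
have ZA : Z *m A = 0 by rewrite mulmxBl mul1mx -mulmxA BA mulmx1 subrr.
(* On the image of [A] the second term vanishes. Off it, [Z *m x] is a nonzero integer vector of
   squared length at least 1, so the weight [m + 1] puts [x] above the minimum [m]. *)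
pose Q' := congr_act B^T Q + (m + 1) *: congr_act Z^T 1%:M.
have Q'E x : qform Q' x = qform Q (map_mx intr B *m x) +
    (m + 1) * qform 1%:M (map_mx intr Z *m x).
  rewrite -!qform_congr_act /qform /Q' mulmxDr mulmxDl mxE; congr (_ + _).
  by rewrite -scalemxAr -scalemxAl mxE.
have m1 : 0 < m + 1 by rewrite ltr_wpDl.
have q10 x : 0 <= (m + 1) * qform 1%:M (map_mx intr Z *m x).
  by rewrite mulr_ge0 ?(ltW m1) // Omega_ge0 //; exact: Omega1.
have Q'A x : qform Q' (intcv R (A *m x)) = qform Q (intcv R x).
  rewrite Q'E -!intcvM !mulmxA BA ZA mul1mx mul0mx.
  by rewrite [intcv R 0]map_mx0 qform0 mulr0 addr0.
have Zx x : Z *m x = 0 -> x = A *m (B *m x).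
  by rewrite mulmxBl mul1mx mulmxA => /eqP; rewrite subr_eq0 => /eqP.
have big x : Z *m x != 0 -> m < qform Q' (intcv R x).
  move=> Zx0; rewrite Q'E -!intcvM.
  apply: (@lt_le_trans _ _ (m + 1)); first by rewrite ltrDl.
  apply: ler_wpDl; first exact: Omega_ge0.
  by rewrite ler_pMr // qform1_int_ge1.
right; exists Q'.
  split=> [|x x0'].
    by rewrite /Q' linearD linearZ /= !congr_act_sym ?trmx1 //; case: oQ.
  rewrite Q'E; have [Zx0|Zx0] := eqVneq (map_mx intr Z *m x) 0.
    apply: ltr_wpDr => //; apply: (proj2 oQ); apply: contra_neq x0' => Bx0.
    move: Zx0; rewrite map_mxB map_mx1 mulmxBl mul1mx map_mxM -mulmxA Bx0 mulmx0.
    by rewrite subr0.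
  apply: ltr_wpDl; first exact: Omega_ge0.
  by rewrite mulr_gt0 // (proj2 (@Omega1 R p)).
congr conic_hull; apply/seteqP; split=> _ [x mx <-].
  exists (A *m x); last by rewrite /= congr_act_rank1.
  case: mx => x_0 mx; split=> [|y y0]; first exact: mul_cancel_neq0 BA x_0.
  rewrite Q'A; have [/Zx yE|/big/ltW] := eqVneq (Z *m y) 0.
    by rewrite yE Q'A mx //; apply: contra_neq y0 => By0; rewrite yE By0 mulmx0.
  by apply: le_trans; apply: mx; case: mx0.
have [x_0 mx'] := mx.
have /Zx xE : Z *m x = 0.
  apply: contraPP (mx' (A *m x0) _) => [/eqP/big lt|].
    by rewrite Q'A -/m leNgt lt.
  by apply: mul_cancel_neq0 BA _; case: mx0.
exists (B *m x); last by rewrite /= congr_act_rank1 -xE.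
split=> [|y y0]; first by apply: contra_neq x_0 => Bx0; rewrite xE Bx0 mulmx0.
by rewrite -!Q'A -xE; apply: mx'; exact: mul_cancel_neq0 BA y0.
Qed.

End Congruence.

(** * Faces of perfect cones *)

Section PerfectFaces.
Variables (R : realType) (g : nat).
Local Notation form := 'M[R]_g.
Implicit Types (Q N : form) (l : {scalar form}).

Lemma scalar_rank1E l : exists N, N^T = N /\
  forall x : 'cV[R]_g, l (x *m x^T) = qform N x.
Proof.
pose c i j := l (delta_mx i j).
exists (\matrix_(i, j) ((c i j + c j i) / 2)); split.
  by apply/matrixP => i j; rewrite !mxE addrC.
move=> x; have lE : l (x *m x^T) = \sum_i \sum_j x i 0 * x j 0 * c i j.
  rewrite [x *m x^T]matrix_sum_delta linear_sum; apply: eq_bigr => i _.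
  rewrite linear_sum; apply: eq_bigr => j _; rewrite linearZ /=.
  by rewrite mxE big_ord1 mxE.
have qE : qform (\matrix_(i, j) ((c i j + c j i) / 2)) x =
    \sum_i \sum_j x i 0 * x j 0 * ((c i j + c j i) / 2).
  rewrite /qform mxE exchange_big; apply: eq_bigr => j _.
  rewrite mxE mulr_suml; apply: eq_bigr => i _; rewrite !mxE; ring.
rewrite lE qE; under [RHS]eq_bigr => i _ do
  (under eq_bigr => j _ do rewrite mulrA mulrDr mulrDl; rewrite big_split).
rewrite big_split /= [X in _ + X]exchange_big /= -big_split; apply: eq_bigr => i _.
by rewrite -big_split; apply: eq_bigr => j _ /=; rewrite (mulrC (x j 0)); lra.
Qed.

Lemma qform_bound Q N : Omega Q ->
  exists2 K, 0 <= K & forall x, `|qform N x| <= K * qform Q x.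
Proof.
move=> oQ; have [C C0 CP] := Omega_coord_bound oQ.
exists (\sum_i \sum_j `|N i j| * C) => [|x].
  by apply: sumr_ge0 => i _; apply: sumr_ge0 => j _; rewrite mulr_ge0.
have -> : qform N x = \sum_i \sum_j N i j * (x i 0 * x j 0).
  rewrite /qform mxE exchange_big; apply: eq_bigr => j _.
  rewrite mxE mulr_suml; apply: eq_bigr => i _; rewrite !mxE; ring.
rewrite mulr_suml; apply: le_trans (ler_norm_sum _ _ _) _; apply: ler_sum => i _.
rewrite mulr_suml; apply: le_trans (ler_norm_sum _ _ _) _; apply: ler_sum => j _.
rewrite normrM -mulrA ler_wpM2l //.
have := CP x i; have := CP x j; move: (x i 0) (x j 0) (C * _) => a b d bd ad.
rewrite ler_norml; apply/andP; split.
  by have := sqr_ge0 (a + b); rewrite sqrrD; lra.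
by have := sqr_ge0 (a - b); rewrite sqrrB; lra.
Qed.

(** Only finitely many integer vectors have value at most [m + 1]; the gap is 1 or the distance to
    the next value among them. *)
Lemma min_vectors_gap Q x0 : Omega Q -> min_vectors Q x0 ->
  exists2 e, 0 < e & forall y : 'cV[int]_g, y != 0 -> ~ min_vectors Q y ->
    qform Q (intcv R x0) + e <= qform Q (intcv R y).
Proof.
move=> oQ mx0; set m := qform Q (intcv R x0).
have [s sP] := Omega_finite (m + 1) oQ.
pose P (y : 'cV[int]_g) := (y != 0) && ~~ `[< min_vectors Q y >].
have Pm y : P y -> m < qform Q (intcv R y).
  move=> /andP[y0 /asboolPn nmy]; rewrite ltNge; apply/negP => ym; apply: nmy.
  by split=> // z z0; apply: le_trans ym _; exact: (proj2 mx0).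
have PI y : y != 0 -> ~ min_vectors Q y -> P y by move=> y0 /asboolPn; rewrite /P y0.
have [/(seq_argmin (fun y => qform Q (intcv R y)))[b [_ Pb] bmin]|/hasPn nP] :=
  boolP (has P s).
  exists (Num.min 1 (qform Q (intcv R b) - m)); first by rewrite lt_min ltr01 subr_gt0 Pm.
  move=> y y0 /(PI _ y0) Py; have [ym|ym] := lerP (qform Q (intcv R y)) (m + 1).
    have := bmin _ (sP _ ym) Py; rewrite minEle; case: ifP => h; lra.
  by apply: le_trans (ltW ym); rewrite lerD2l ge_min lexx.
exists 1 => // y y0 /(PI _ y0) Py.
by case: lerP => // /ltW/sP/nP; rewrite Py.
Qed.

(* A face [l = 0] of [sigma[Q]] is [sigma[Q + d N]] for small [d > 0], where
   [N x = l (x x^T)]. *)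
Lemma perfect_cone_face rho (sigma : set form) : perfect_cone sigma ->
  is_face rho sigma -> perfect_cone rho.
Proof.
move=> [->|[Q oQ ->]] [l [l0 ->]].
  by left; apply/seteqP; split=> [v [-> _]|_ ->] //; split=> //; exact: linear0.
have [s sE] := min_vectors_seq oQ.
have coneE (M : set 'cV[int]_g) (t : seq 'cV[int]_g) : M = [set` t] ->
    [set rank1 R x | x in M] = [set` map (@rank1 R g) t].
  move=> ->; apply/seteqP; split=> v /=; first by move=> [x xt <-]; exact: map_f.
  by move=> /mapP[x xt ->]; exists x.
have sigmaE : sigma_cone Q = conic_hull [set` map (@rank1 R g) s].
  by rewrite -(coneE _ _ sE).
rewrite sigmaE in l0 *; rewrite face_conic_hull //.
pose p := fun x : 'cV[int]_g => l (rank1 R x) == 0.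
have -> : seq.filter (fun v => l v == 0) (map (@rank1 R g) s) =
    map (@rank1 R g) (seq.filter p s) by rewrite filter_map.
(* If no minimal vector lies on the face, the face is the zero cone, perfect by convention rather
   than by perturbation. *)
have [/hasP[x1 x1s px1]|nop] := boolP (has p s); last first.
  left; suff -> : seq.filter p s = [::].
    by rewrite -[RHS]conic_hull_set0; congr conic_hull; apply/seteqP; split.
  by apply/eqP; rewrite -[_ == _]negbK -has_filter.
have mx1 : min_vectors Q x1 by rewrite sE.
set m := qform Q (intcv R x1).
have [e e0 eP] := min_vectors_gap oQ mx1; rewrite -/m in eP.
have [N [sN NE]] := scalar_rank1E l.
have [K K0 KP] := qform_bound N oQ.
have m0 : 0 < m by apply: (proj2 oQ); rewrite intcv_eq0; case: mx1.
(* Chosen so that [(1 - d * K) * (m + e)] still exceeds [m]: vectors that were not minimal stay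
   above [m], and [1 - d * K > 0] keeps the form definite. *)
pose d := e / ((K + 1) * (m + e)).
have K1 : 0 < K + 1 by rewrite ltr_wpDl.
have me : 0 < m + e by rewrite addr_gt0.
have d0 : 0 < d by rewrite divr_gt0 ?mulr_gt0.
have dE : d * (K + 1) * (m + e) = e.
  by rewrite -mulrA divfK // gt_eqF ?mulr_gt0.
have dK1 : d * K < 1.
  rewrite -(ltr_pM2r me) mul1r; apply: (@le_lt_trans _ _ e); last by rewrite ltrDr.
  by rewrite -[leRHS]dE ler_wpM2r ?ltW // ltr_pM2l // ltrDl.
have dKm : m < (1 - d * K) * (m + e).
  rewrite mulrBl mul1r ltrBrDl -[X in _ < m + X]dE addrC ltrD2l ltr_pM2r //.
  by rewrite ltr_pM2l // ltrDl.
pose Q' := Q + d *: N.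
have Q'E x : qform Q' x = qform Q x + d * qform N x.
  rewrite /qform /Q' mulmxDr mulmxDl mxE; congr (_ + _).
  by rewrite -scalemxAr -scalemxAl mxE.
have Q'ge x : (1 - d * K) * qform Q x <= qform Q' x.
  rewrite Q'E -subr_ge0.
  have -> : qform Q x + d * qform N x - (1 - d * K) * qform Q x =
    d * (qform N x + K * qform Q x) by ring.
  rewrite mulr_ge0 ?(ltW d0) // -lerBlDr sub0r lerNl.
  by apply: le_trans (KP x); rewrite -normrN ler_norm.
have Q'1 : qform Q' (intcv R x1) = m.
  by rewrite Q'E -NE (eqP px1) mulr0 addr0.
have Q'm x : min_vectors Q x -> qform Q' (intcv R x) = m + d * l (rank1 R x).
  move=> mx; rewrite Q'E -NE; congr (_ + _); apply/le_anti/andP; split.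
    by apply: (proj2 mx); case: mx1.
  by apply: (proj2 mx1); case: mx.
have lge x : min_vectors Q x -> 0 <= l (rank1 R x).
  by rewrite sE => xs; apply/l0/conic_hull_sub/map_f.
have Q'gt x : x != 0 -> ~ min_vectors Q x -> m < qform Q' (intcv R x).
  move=> x0 nmx; apply: lt_le_trans dKm _; apply: le_trans (Q'ge _).
  by rewrite ler_wpM2l ?subr_ge0 ?(ltW dK1) // eP.
right; exists Q'.
  split=> [|x x0]; first by rewrite /Q' linearD linearZ /= sN; case: oQ => ->.
  by apply: lt_le_trans (Q'ge x); rewrite mulr_gt0 ?subr_gt0 // (proj2 oQ).
rewrite /sigma_cone (coneE _ (seq.filter p s)) //.
apply/seteqP; split=> x /=; rewrite mem_filter.
  move=> [x0 mx']; have := mx' x1 (proj1 mx1); rewrite Q'1 => xm.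
  have mx : min_vectors Q x.
    by apply: contrapT => /(Q'gt _ x0); rewrite ltNge xm.
  have -> : x \in s by move: (mx); rewrite sE.
  rewrite andbT /p eq_le lge // andbT; move: xm; rewrite Q'm //.
  by rewrite gerDl pmulr_rle0.
move=> /andP[px xs]; have mx : min_vectors Q x by rewrite sE.
split=> [|y y0]; first by case: mx.
rewrite Q'm // (eqP px) mulr0 addr0.
have [my|/(Q'gt _ y0)/ltW//] := pselect (min_vectors Q y).
by rewrite Q'm // lerDl mulr_ge0 ?lge // ltW.
Qed.

End PerfectFaces.

(** * Equivalence of cones across dimensions *)

Lemma col_mulmx (K : pzSemiRingType) m n p (M : 'M[K]_(m, n)) (N : 'M[K]_(n, p)) j :
  col j (M *m N) = M *m col j N.
Proof. by rewrite !colE mulmxA. Qed.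

Lemma eq_cols (K : Type) m n (M N : 'M[K]_(m, n)) :
  (forall j, col j M = col j N) -> M = N.
Proof. by move=> MN; apply/matrixP => i j; have /colP/(_ i) := MN j; rewrite !mxE. Qed.

Section Extension.
Variables (R : realType) (p q : nat) (A : 'M[int]_(p, q)) (B : 'M[int]_(q, p)).
Hypothesis BA : B *m A = 1%:M.
Implicit Types (sigma : set 'M[R]_q) (h : 'M[int]_q) (k : 'M[int]_p).

Let Z : 'M[int]_p := 1%:M - A *m B.

Let ZA : Z *m A = 0.
Proof. by rewrite /Z mulmxBl mul1mx -mulmxA BA mulmx1 subrr. Qed.

Let BZ : B *m Z = 0.
Proof. by rewrite /Z mulmxBr mulmx1 mulmxA BA mul1mx subrr. Qed.

Let ZZ : Z *m Z = Z.
Proof. by rewrite {2}/Z mulmxBr mulmx1 mulmxA ZA mul0mx subr0. Qed.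

(** The projection [Z] kills every form in the image of [A], hence also [rank1 z], and a rank one
    form vanishes only when its vector does. *)
Lemma rank1_congr_act (z : 'cV[int]_p) (Q : 'M[R]_q) :
  rank1 R z = congr_act A Q -> z = A *m (B *m z).
Proof.
move=> zE; have : rank1 R (Z *m z) = 0.
  rewrite -congr_act_rank1 zE -congr_act_mul ZA.
  by rewrite /congr_act map_mx0 !mul0mx.
move=> /rank1_eq0; rewrite /Z mulmxBl mul1mx mulmxA => /eqP.
by rewrite subr_eq0 => /eqP.
Qed.

(** The lift is [h] on the image of [A] and the identity on the complement, the image of [Z]. *)
Lemma unimodular_lift h : h \in unitmx ->
  exists2 k, k \in unitmx & k *m A = A *m h.
Proof.
move=> uh; exists (A *m h *m B + Z); last first.
  by rewrite mulmxDl ZA addr0 -(mulmxA (A *m h) B A) BA mulmx1.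
suff /mulmx1_unit[//] : (A *m h *m B + Z) *m (A *m invmx h *m B + Z) = 1%:M.
set h' := invmx h.
have -> : (A *m h *m B + Z) *m (A *m h' *m B + Z) = A *m h *m B *m (A *m h' *m B)
    + A *m h *m B *m Z + (Z *m (A *m h' *m B) + Z *m Z).
  by rewrite mulmxDl (mulmxDr (A *m h *m B)) (mulmxDr Z).
rewrite ZZ -(mulmxA (A *m h) B Z) BZ mulmx0 addr0 (mulmxA Z (A *m h') B).
rewrite (mulmxA Z A h') ZA !mul0mx add0r -(mulmxA (A *m h) B) (mulmxA B (A *m h') B).
rewrite (mulmxA B A h') BA mul1mx -(mulmxA A h) (mulmxA h h' B) mulmxV // mul1mx.
by rewrite /Z addrC subrK.
Qed.

(* [k] need not preserve the image of [A], but the generators of the first cone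
   and their images under [k] span the same row lattice. *)
Lemma unimodular_restrict k sigma sigma' : k \in unitmx -> perfect_cone sigma ->
  congr_act k @` (congr_act A @` sigma) = congr_act A @` sigma' ->
  exists h, [/\ h \in unitmx, congr_act h @` sigma = sigma' &
    forall v, v \in lspan sigma ->
      congr_act k (congr_act A v) = congr_act A (congr_act h v)].
Proof.
move=> uk /perfect_cone_seq[s _ sE] kE.
pose X : 'M[int]_(q, size s) := \matrix_(i, j) (nth 0 s j) i 0.
have colX (j : 'I_(size s)) : col j X = nth 0 s j.
  by apply/colP => i; rewrite !mxE.
(* Compressions of [k] and its inverse to the small lattice. They need not be inverse to each other,
   but [C' *m C] fixes the generators [X], which is what [unimodular_factor] asks for. *)
pose C : 'M[int]_q := B *m k *m A; pose C' : 'M[int]_q := B *m invmx k *m A.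
have kx x : x \in s -> k *m A *m x = A *m (C *m x).
  move=> xs; have : (congr_act A @` sigma') (rank1 R (k *m A *m x)).
    rewrite -kE -mulmxA -!congr_act_rank1; exists (congr_act A (rank1 R x)) => //.
    by exists (rank1 R x) => //; rewrite sE; apply/conic_hull_sub/map_f.
  by move=> [Q _ /esym/rank1_congr_act ->]; rewrite /C !mulmxA.
have kX : k *m A *m X = A *m (C *m X).
  by apply: eq_cols => j; rewrite !col_mulmx colX; apply: kx; exact: mem_nth.
have XE : X = C' *m (C *m X).
  rewrite /C' -2!mulmxA -kX -!mulmxA mulKmx // mulmxA.
  by rewrite BA mul1mx.
have [h uh CXE] := unimodular_factor erefl XE.
have hx x : x \in s -> k *m A *m x = A *m h *m x.
  move=> xs; rewrite kx //; have xj : (index x s < size s)%N by rewrite index_mem.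
  have <- : col (Ordinal xj) X = x by rewrite colX nth_index.
  by rewrite -!col_mulmx CXE mulmxA.
have spanE v : v \in lspan sigma ->
    congr_act k (congr_act A v) = congr_act A (congr_act h v).
  have /subvP sub : (lspan sigma <=
      lker (linfun (@congr_act R _ _ (k *m A)) - linfun (@congr_act R _ _ (A *m h))))%VS.
    rewrite sE lspan_conic_hull; apply/span_subvP => _ /mapP[x xs ->].
    by rewrite memv_ker add_lfunE opp_lfunE !lfunE /= !congr_act_rank1 hx // subrr.
  move=> /sub; rewrite memv_ker add_lfunE opp_lfunE !lfunE /= subr_eq0 => /eqP.
  by rewrite !congr_act_mul.
exists h; split=> //.
apply: (@image_cone_inj _ _ _ _ _ (congr_actK (R := R) BA)).
rewrite -kE; apply/seteqP; split=> _ [_ [v sv <-] <-].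
  by exists (congr_act A v); [exists v|rewrite spanE // lspan_mem].
by exists (congr_act h v); [exists v|exact/esym/spanE/lspan_mem].
Qed.

Lemma same_orbit_image sigma sigma' : perfect_cone sigma ->
  same_orbit (congr_act A @` sigma) (congr_act A @` sigma') <->
  same_orbit sigma sigma'.
Proof.
move=> ps; split=> [[k uk kE]|[h uh ->]].
  have [h [uh hE _]] := unimodular_restrict uk ps (esym kE).
  by exists h.
have [k uk kA] := unimodular_lift uh; exists k => //.
change (congr_act A @` (congr_act h @` sigma) = congr_act k @` (congr_act A @` sigma)).
by rewrite -!image_congr_act_mul kA.
Qed.

End Extension.

Section Alternating.
Variable R : realType.

(** On the image of [X] the transported orientation has the sign that [o] has on [X]. Comparing
    there leaves only the sign of a determinant, independent of [o]. *)
Lemma stabilizer_orientation g (sigma : set 'M[R]_g) (h : 'M[int]_g) o X :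
  h \in unitmx -> gl_act_cone h sigma = sigma -> is_orientation (lspan sigma) o ->
  basis_of (lspan sigma) X ->
  (gl_act_orientation h o = o <-> 0 < basis_change_det X (map (congr_act h) X)).
Proof.
move=> uh hs oS bX; have hK := congr_actK (R := R) (mulVmx uh).
have hso : is_orientation (lspan sigma) (map (congr_act h) @` o).
  by rewrite -[in lspan _]hs; exact: (orientation_image hK oS).
have bhX : basis_of (lspan sigma) (map (congr_act h) X).
  by rewrite -[in lspan _]hs (lspan_image hK); exact: (basis_of_map hK bX).
have hsign : basis_sign (map (congr_act h) @` o) (map (congr_act h) X) = basis_sign o X.
  exact: basis_sign_map hK _ _.
have signE := basis_sign_orientation oS bX bhX; have XX := basis_sign_sqr o X.
split=> [ho|d0].
  move: signE; rewrite -[in LHS]ho hsign; case: ltrP => // _ /(congr1 ( *%R (basis_sign o X))).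
  by rewrite mulN1r mulrN XX; lra.
apply: (orientation_eq hso oS bhX); apply: basis_signP.
by rewrite hsign signE d0 mul1r.
Qed.

Lemma alternatingP g (sigma : set 'M[R]_g) X : basis_of (lspan sigma) X ->
  alternating sigma <-> perfect_cone sigma /\
  forall h, h \in unitmx -> gl_act_cone h sigma = sigma ->
    0 < basis_change_det X (map (congr_act h) X).
Proof.
move=> bX; split=> [[ps alt]|[ps alt]]; split=> // h uh hs.
  have oS := basis_orientationP bX.
  by apply/(stabilizer_orientation uh hs oS bX); exact: alt.
by move=> o oS; apply/(stabilizer_orientation uh hs oS bX); exact: alt.
Qed.

(** Stabilizers of the cone and of its image lift and restrict to each other with equal action on
    the span, hence with the same determinant. *)
Lemma alternating_image p q (A : 'M[int]_(p, q)) B (sigma : set 'M[R]_q) :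
  B *m A = 1%:M -> perfect_cone sigma ->
  alternating (congr_act A @` sigma) <-> alternating sigma.
Proof.
move=> BA ps; have AK := congr_actK (R := R) BA.
have bX := vbasisP (lspan sigma); set X := vbasis _ : seq 'M[R]_q in bX.
have bAX : basis_of (lspan (congr_act A @` sigma)) (map (congr_act A) X).
  by rewrite (lspan_image AK); exact: (basis_of_map AK bX).
have hX (h : 'M[int]_q) : h \in unitmx -> gl_act_cone h sigma = sigma ->
    forall y, y \in map (congr_act h) X -> y \in lspan sigma.
  move=> uh hs _ /mapP[x /(basis_mem bX) xs ->].
  rewrite -[in lspan _]hs (lspan_image (congr_actK (R := R) (mulVmx uh))).
  by rewrite (mem_map_space (congr_actK (mulVmx uh))).
rewrite (alternatingP bAX) (alternatingP bX); split=> -[_ alt]; split.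
- exact: ps.
- move=> h uh hs; have [k uk kA] := unimodular_lift BA uh.
  rewrite -(basis_change_det_map AK bX (hX h uh hs)) -map_comp.
  have -> : map (congr_act A \o congr_act h) X =
      map (congr_act k) (map (congr_act A) X).
    by rewrite -map_comp; apply: eq_map => v /=; rewrite -!congr_act_mul kA.
  apply: alt => //; change (congr_act k @` (congr_act A @` sigma) = congr_act A @` sigma).
  by rewrite -image_congr_act_mul kA image_congr_act_mul; congr image.
- exact: perfect_cone_image BA ps.
- move=> k uk kE; have [h [uh hs hE]] := unimodular_restrict BA uk ps kE.
have -> : map (congr_act k) (map (congr_act A) X) =
    map (congr_act A) (map (congr_act h) X).
  rewrite -!map_comp; apply/eq_in_map => v /(basis_mem bX) vs /=; exact: hE.
by rewrite (basis_change_det_map AK bX (hX h uh hs)) alt.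
Qed.

End Alternating.

(** * Perfect cones that contain no positive definite form *)

Section Degenerate.
Variables (R : realType) (g : nat).

Definition widen_mx : 'M[int]_(g.+1, g) := pid_mx g.
Definition narrow_mx : 'M[int]_(g, g.+1) := pid_mx g.

Lemma narrow_widen_mx : narrow_mx *m widen_mx = 1%:M.
Proof. by rewrite mul_pid_mx minnn (minn_idPr (leqnSn g)) pid_mx_1. Qed.

Lemma widen_mx_degenerate Q : ~ @Omega R g.+1 (congr_act widen_mx Q).
Proof.
pose x : 'cV[R]_g.+1 := delta_mx ord_max 0.
have x0 : x != 0.
  by apply/eqP => /colP/(_ ord_max)/eqP; rewrite !mxE !eqxx oner_eq0.
move=> [_ /(_ x x0)]; rewrite /qform /congr_act -!mulmxA.
suff -> : (map_mx intr widen_mx)^T *m x = 0 by rewrite !mulmx0 mxE ltxx.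
apply/colP => i; rewrite !mxE big1 // => j _; rewrite !mxE.
have [->|_] := eqVneq j ord_max; last by rewrite mulr0.
by rewrite /= gtn_eqF // mul0r.
Qed.

Lemma perfect_cone_degenerate (sigma : set 'M[R]_g.+1) : perfect_cone sigma ->
  sigma `&` @Omega R g.+1 = set0 ->
  exists tau (h : 'M[int]_g.+1), [/\ perfect_cone tau, h \in unitmx &
    sigma = congr_act h @` (congr_act widen_mx @` tau)].
Proof.
move=> [->|[Q oQ ->]] sO.
  exists [set 0], 1%:M; split; [by left|exact: unitmx1|].
  by rewrite !image_set1 !linear0.
have [s sE] := min_vectors_seq oQ.
pose X : 'M[int]_(g.+1, size s) := \matrix_(i, j) (nth 0 s j) i 0.
have [L [r [uL rg eX annX]]] := saturation R X.
(* At full rank the sum of the rank one forms of all minimal vectors would be positive definite and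
   lie in the cone. *)
have {}rg : (r <= g)%N.
  rewrite leqNgt; apply/negP => gr; have {rg gr}rE : r = g.+1 by apply/anti_leq/andP.
  suff : (set0 : set 'M[R]_g.+1) (\sum_(x <- s) rank1 R x) by [].
  rewrite -sO; split.
    rewrite big_seq; elim/big_ind: _ => [|u v|x xs]; [exact: conic_hull0|exact: conic_hullD|].
    by apply: conic_hull_sub; exists x => //; rewrite sE.
  have qE (y : 'cV[R]_g.+1) : qform (\sum_(x <- s) rank1 R x) y =
      \sum_(x <- s) (bform 1%:M y (intcv R x)) ^+ 2.
    rewrite /qform mulmx_sumr mulmx_suml summxE; apply: eq_bigr => x _.
    rewrite /rank1 !mulmxA -mulmxA mxE big_ord1 expr2 {2}bformC ?trmx1 //.
    by rewrite /bform !mulmx1.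
  split=> [|y y0].
    by rewrite linear_sum; apply: eq_bigr => x _; rewrite /= trmx_mul trmxK.
  rewrite qE lt0r sumr_ge0 ?andbT => [|x _]; last exact: sqr_ge0.
  apply: contra_neq y0 => /eqP; rewrite psumr_eq0 => [/allP ys|x _]; last exact: sqr_ge0.
  have yX : y^T *m map_mx intr X = 0.
    apply/rowP => j; rewrite [RHS]mxE.
    have /= := ys _ (mem_nth 0 (ltn_ord j)); rewrite sqrf_eq0 => /eqP <-.
    rewrite /bform mulmx1 !mxE; apply: eq_bigr => i _.
    by rewrite !mxE.
  have := annX _ _ yX; rewrite rE pid_mx_1 mulmx1 => yL.
  apply: trmx_inj; rewrite trmx0 -[LHS]mulmx1 -(map_mx1 (intr : int -> R)).
  by rewrite -(mulmxV uL) map_mxM mulmxA yL mul0mx.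
(* [A] consists of the first [g] columns of [L]. As [r <= g], they span a lattice containing all
   minimal vectors, and the smaller cone comes from the restriction of [Q] to it. *)
pose A := L *m widen_mx; pose B := narrow_mx *m invmx L.
have BA : B *m A = 1%:M by rewrite /A /B -mulmxA mulKmx // narrow_widen_mx.
have ABx x : x \in s -> x = A *m (B *m x).
  move=> xs; rewrite /A /B -!mulmxA [X in L *m X]mulmxA /widen_mx /narrow_mx mul_pid_mx !minnn.
  have xj : (index x s < size s)%N by rewrite index_mem.
  have <- : col (Ordinal xj) X = x.
    by apply/colP => i; rewrite !mxE nth_index.
  rewrite -!col_mulmx -eX [Y in L *m Y]mulmxA mul_pid_mx.
  by rewrite (minn_idPr rg) (minn_idPr (leqW rg)) eX mulKVmx.
exists (sigma_cone (congr_act A^T Q)), L; split=> //.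
  by right; exists (congr_act A^T Q) => //; exact: Omega_pull BA oQ.
rewrite -image_congr_act_mul -/A image_conic_hull image_comp; congr conic_hull.
have qA y : qform (congr_act A^T Q) (intcv R y) = qform Q (intcv R (A *m y)).
  by rewrite qform_congr_act intcvM.
apply/seteqP; split=> _ [x mx <-].
  have xs : x \in s by move: (mx); rewrite sE.
  exists (B *m x); last by rewrite /= congr_act_rank1 -ABx.
  have [x0 xmin] := mx; split.
    by apply: contra_neq x0 => Bx0; rewrite (ABx x xs) Bx0 mulmx0.
  by move=> y y0; rewrite !qA -ABx //; apply/xmin/(mul_cancel_neq0 BA).
have [x0 xmin] := mx.
exists (A *m x); last by rewrite /= congr_act_rank1.
(* A minimal vector [z] of [Q] lies in the image of [A], so the restricted form has the same minimum
   as [Q]. *)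
have Ax0 := mul_cancel_neq0 BA x0; have [z mz] := min_vectors_neq0 oQ Ax0.
have zs : z \in s by move: (mz); rewrite sE.
split=> // y y0; apply: le_trans (proj2 mz y y0).
rewrite (ABx z zs) -!qA; apply: xmin.
by apply: contra_neq (proj1 mz) => Bz0; rewrite (ABx z zs) Bz0 mulmx0.
Qed.

End Degenerate.

(** * Classes of cones in the perfect complex *)

Section FreeModules.
Variable K : choiceType.

Lemma freeg_scaleU (c : rat) (k : K) : << c *g k >> = c *: << k >> :> {freeg K / rat}.
Proof. by apply/eqP/freeg_eqP => z; rewrite coeffZ !coeffU mul1r. Qed.

Lemma freeg_ind (P : {freeg K / rat} -> Prop) : P 0 ->
  (forall x y, P x -> P y -> P (x + y)) -> (forall c k, P (c *: << k >>)) ->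
  forall x, P x.
Proof.
move=> P0 PD PZ x; rewrite -[x]freeg_sumE; elim/big_ind: _ => // k _.
by rewrite freeg_scaleU.
Qed.

Lemma free_liftU (M : lmodType rat) (f : K -> M) k : free_lift f << k >> = f k.
Proof. by rewrite /free_lift /= liftU scale1r. Qed.

End FreeModules.

(** The list [r] exhibits a finite support, without which the sum over all of [B (n - 1)] would take
    its default value 0. *)
Lemma cone_complex_diffE (T : Type) (B : int -> set (set T)) d n (s : B n)
    (r : seq (B (n - 1))) : uniq r ->
  (forall t : B (n - 1), t \notin r -> d (val t) (val s) = 0) ->
  diff (cone_complex B d) n << s >> = \sum_(t <- r) d (val t) (val s) *: << t >>.
Proof.
move=> ur r0; rewrite /= free_liftU (fsbigE r) //= => [|t _ /r0 ->]; last exact: scale0r.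
by apply: eq_bigl => t; rewrite mem_set.
Qed.

Section Orbits.
Variables (R : realType) (g : nat).
Implicit Types (rho sigma tau : set 'M[R]_g) (h : 'M[int]_g).

Lemma same_orbit_refl sigma : same_orbit sigma sigma.
Proof. by exists 1%:M; [exact: unitmx1|rewrite [RHS]image_congr_act1]. Qed.

Lemma same_orbit_sym rho sigma : same_orbit rho sigma -> same_orbit sigma rho.
Proof.
move=> [h uh ->]; exists (invmx h); first by rewrite unitmx_inv.
by rewrite [RHS](_ : _ = congr_act (invmx h) @` (congr_act h @` rho)) //
  -image_congr_act_mul mulVmx // image_congr_act1.
Qed.

Lemma same_orbit_trans rho sigma tau :
  same_orbit rho sigma -> same_orbit sigma tau -> same_orbit rho tau.
Proof.
move=> [h uh ->] [k uk ->]; exists (k *m h); first by rewrite unitmx_mul uk uh.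
exact/esym/image_congr_act_mul.
Qed.

Lemma alternating_orbit rho sigma : alternating rho -> same_orbit rho sigma ->
  alternating sigma.
Proof.
move=> alt [h uh ->]; apply/(alternating_image (mulVmx uh)) => //.
by case: alt.
Qed.

Lemma cone_dim_orbit rho sigma : same_orbit rho sigma -> cone_dim sigma = cone_dim rho.
Proof.
by move=> [h uh ->]; exact: (cone_dim_image (congr_actK (R := R) (mulVmx uh))).
Qed.

End Orbits.

Section PerfectComplex.
Variables (R : realType) (g : nat) (D : cone_choice R g).
Implicit Types (rho sigma tau : set 'M[R]_g) (h : 'M[int]_g) (n : int).

Let orbK h (uh : h \in unitmx) := congr_actK (R := R) (mulVmx uh).

Lemma Gamma_perfect n sigma : Gamma D n sigma -> perfect_cone sigma.
Proof. by move=> /Gamma_alternating[[]]. Qed.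

Lemma Gamma_unique n sigma sigma' rho : Gamma D n sigma -> Gamma D n sigma' ->
  same_orbit sigma rho -> same_orbit sigma' rho -> sigma = sigma'.
Proof.
move=> Gs Gs' sr sr'; have [alt dim] := Gamma_alternating Gs.
have dr : (cone_dim rho)%:Z = n + 1 by rewrite (cone_dim_orbit sr).
have [t [_ tu]] := Gamma_representative D (alternating_orbit alt sr) dr.
by rewrite -(tu sigma) // -(tu sigma').
Qed.

(** Two ways of writing the cone as a translate use the same representative and differ by an element
    of its stabilizer, which preserves the orientation because the representative is alternating. *)
Lemma ext_omegaE n sigma h : Gamma D n sigma -> h \in unitmx ->
  ext_omega D (gl_act_cone h sigma) = gl_act_orientation h (omega D sigma).
Proof.
move=> Gs uh; apply/seteqP; split=> X; last by move=> oX; exists n, sigma, h.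
move=> [n' [sigma' [h' [Gs' uh' hE]]]].
have o1 : same_orbit sigma (gl_act_cone h sigma) by exists h.
have o2 : same_orbit sigma' (gl_act_cone h sigma) by exists h'.
have nE : n' = n.
  have [_ d1] := Gamma_alternating Gs; have [_ d2] := Gamma_alternating Gs'.
  by apply: (addIr 1); rewrite -d1 -d2 -(cone_dim_orbit o1) -(cone_dim_orbit o2).
rewrite {}nE in Gs'; have sE := Gamma_unique Gs' Gs o2 o1.
rewrite {}sE {sigma'} in Gs' o2 hE *.
have [[_ alt] _] := Gamma_alternating Gs.
have uk : invmx h *m h' \in unitmx by rewrite unitmx_mul unitmx_inv uh.
have kE : gl_act_cone (invmx h *m h') sigma = sigma.
  rewrite [LHS]image_congr_act_mul -[congr_act h' @` sigma]hE.
  by rewrite -[LHS]image_congr_act_mul mulVmx // image_congr_act1.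
have oE := alt _ uk kE _ (omega_orientation Gs).
move=> [Y oY <-]; exists (map (congr_act (invmx h *m h')) Y).
  by rewrite -oE; exists Y.
rewrite -map_comp; apply: eq_map => Q /=.
change (congr_act h (congr_act (invmx h *m h') Q) = congr_act h' Q).
by rewrite -congr_act_mul mulKVmx.
Qed.

(** [ext_omega] is empty off the alternating cones; an arbitrary orientation there makes incidence
    signs computable for every cone. *)
Definition orient sigma : set (seq 'M[R]_g) :=
  if `[< alternating sigma >] then ext_omega D sigma
  else basis_orientation (lspan sigma) (vbasis (lspan sigma)).

Lemma orient_alternating sigma : alternating sigma -> orient sigma = ext_omega D sigma.
Proof. by rewrite /orient; case: asboolP. Qed.

Lemma alternating_Gamma sigma : alternating sigma ->
  exists n tau h, [/\ Gamma D n tau, h \in unitmx & sigma = gl_act_cone h tau].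
Proof.
move=> alt; pose n : int := (cone_dim sigma)%:Z - 1.
have [|tau [[Gt [h uh hE]] _]] := Gamma_representative D (n := n) alt.
  by rewrite subrK.
by exists n, tau, h.
Qed.

Lemma orient_orientation sigma : is_orientation (lspan sigma) (orient sigma).
Proof.
rewrite /orient; case: asboolP => [alt|_]; last exact/basis_orientationP/vbasisP.
have [n [tau [h [Gt uh ->]]]] := alternating_Gamma alt.
by rewrite (ext_omegaE Gt uh); exact: (orientation_image (orbK uh) (omega_orientation Gt)).
Qed.

Lemma orient_act sigma h : alternating sigma -> h \in unitmx ->
  orient (congr_act h @` sigma) = map (congr_act h) @` orient sigma.
Proof.
move=> alt uh; have [n [tau [k [Gt uk sE]]]] := alternating_Gamma alt.
rewrite !orient_alternating //; last by apply: alternating_orbit alt _; exists h.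
have -> : congr_act h @` sigma = gl_act_cone (h *m k) tau.
  by rewrite sE; exact/esym/image_congr_act_mul.
rewrite sE (ext_omegaE Gt uk) (ext_omegaE Gt) ?unitmx_mul ?uh //.
rewrite /gl_act_orientation image_comp; congr image; apply/funext => X /=.
by rewrite -map_comp; apply: eq_map => Q; exact: congr_act_mul.
Qed.

Lemma eta_incidence rho sigma : alternating rho -> alternating sigma ->
  eta D rho sigma = incidence (orient rho) (orient sigma) rho sigma.
Proof. by move=> ar asg; rewrite !orient_alternating. Qed.

Definition orbit_rep n rho : option (Gamma D n) :=
  if pselect (exists s : Gamma D n, same_orbit (val s) rho) is left e
  then Some (projT1 (cid e)) else None.

Lemma orbit_repP n rho (s : Gamma D n) :
  same_orbit (val s) rho <-> orbit_rep n rho = Some s.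
Proof.
rewrite /orbit_rep; case: pselect => [e|ne]; last by split=> // sr; case: ne; exists s.
case: (cid e) => t /= tr; split=> [sr|[<-] //]; congr Some; apply: val_inj.
exact: Gamma_unique (set_valP t) (set_valP s) tr sr.
Qed.

(** The class in the coinvariants of the cone with orientation [orient]. No sign appears because
    [orient] is equivariant on alternating cones; all signs sit in the incidences. *)
Definition orbit_class n rho : {freeg (Gamma D n) / rat} :=
  if orbit_rep n rho is Some s then << s >> else 0.

Lemma orbit_classE n rho (s : Gamma D n) : same_orbit (val s) rho ->
  orbit_class n rho = << s >>.
Proof. by move=> /orbit_repP; rewrite /orbit_class => ->. Qed.

Lemma orbit_class_orbit n rho sigma : same_orbit rho sigma ->
  orbit_class n sigma = orbit_class n rho.
Proof.
move=> rs; rewrite /orbit_class; congr (if _ is Some s then _ else _).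
case: (orbit_rep n rho) (@orbit_repP n rho) => [s|] sP.
  by apply/orbit_repP; apply: same_orbit_trans rs; apply/sP.
case E: (orbit_rep n sigma) => [s|//]; symmetry; apply/sP.
by apply: same_orbit_trans (same_orbit_sym rs); apply/orbit_repP.
Qed.

Lemma orbit_rep_Some n rho : alternating rho -> (cone_dim rho)%:Z = n + 1 ->
  exists s, orbit_rep n rho = Some s.
Proof.
move=> ar dr; have [t [[Gt tr] _]] := Gamma_representative D ar dr.
by exists (SigSub (mem_set Gt)); apply/orbit_repP.
Qed.

Lemma orbit_class_eq0 n rho : ~ (alternating rho /\ (cone_dim rho)%:Z = n + 1) ->
  orbit_class n rho = 0.
Proof.
rewrite /orbit_class; case E: orbit_rep => [s|//] []; move/orbit_repP: E => sr.
have [alt dim] := Gamma_alternating (set_valP s).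
by split; [exact: alternating_orbit alt sr|rewrite (cone_dim_orbit sr)].
Qed.

End PerfectComplex.

(** * The boundary map *)

Section Boundary.
Variables (R : realType) (g : nat) (D : cone_choice R g).
Implicit Types (rho sigma tau : set 'M[R]_g) (h : 'M[int]_g) (n : int).

Let orbK h (uh : h \in unitmx) := congr_actK (R := R) (mulVmx uh).

Lemma deltaE sigma' sigma : perfect_cone sigma ->
  delta D sigma' sigma =
  \sum_(rho <- facets sigma | `[< same_orbit sigma' rho >]) eta D rho sigma.
Proof.
move=> /perfect_pointed ps.
rewrite big_seq_cond bigfs ?facets_uniq // => [|rho /andP[-> //]].
apply: eq_fsbigl; apply/seteqP; split=> rho /=.
  by move=> [fr sr]; apply/andP; split; [exact/facetsP|exact/asboolP].
by move=> /andP[/(facetsP _ ps) fr /asboolP].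
Qed.

Lemma facet_perfect rho sigma : perfect_cone sigma -> is_facet rho sigma ->
  perfect_cone rho.
Proof. by move=> ps [fr _]; exact: perfect_cone_face ps fr. Qed.

Lemma facet_degree n rho sigma : is_facet rho sigma ->
  (cone_dim sigma)%:Z = n + 1 -> (cone_dim rho)%:Z = n - 1 + 1.
Proof. by move=> [_ <-] dE; rewrite subrK; move: dE; lia. Qed.

Definition facet_reps n sigma : seq (Gamma D (n - 1)) :=
  undup (pmap (orbit_rep D (n - 1)) (facets sigma)).

Lemma delta_outside n sigma (t : Gamma D (n - 1)) : perfect_cone sigma ->
  t \notin facet_reps n sigma -> delta D (val t) sigma = 0.
Proof.
move=> ps; rewrite mem_undup => nt; rewrite deltaE // big_seq_cond big1 //.
move=> rho /andP[fr /asboolP/orbit_repP tE]; case/negP: nt.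
by rewrite mem_pmap; apply/mapP; exists rho.
Qed.

(** [delta] groups the facets by orbit. After exchanging the sums each facet contributes to the one
    representative of its orbit, or to nothing if there is none. *)
Lemma boundary_generator n (s : Gamma D n) :
  diff (perfect_complex D) n << s >> =
  \sum_(rho <- facets (val s))
    incidence (orient D rho) (orient D (val s)) rho (val s) *: orbit_class D (n - 1) rho.
Proof.
have [[ps _] _] := Gamma_alternating (set_valP s).
have [alt _] := Gamma_alternating (set_valP s).
rewrite (@cone_complex_diffE _ _ _ _ _ (facet_reps n (val s))); last 2 first.
- exact: undup_uniq.
- by move=> t; exact: delta_outside.
under eq_bigr => t _ do rewrite deltaE // scaler_suml big_mkcond.
rewrite exchange_big /= [LHS]big_seq [RHS]big_seq; apply: eq_bigr => rho fr.
rewrite -big_mkcond /=; under eq_bigl => t do rewrite (asbool_equiv_eq (orbit_repP _ _)).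
rewrite /orbit_class; case E: (orbit_rep D (n - 1) rho) => [t0|]; last first.
  by rewrite big_pred0 ?scaler0 // => t; apply/asboolP.
rewrite (eq_bigl (pred1 t0)) => [|t]; last by apply/asboolP/eqP => [[->]|->].
have t0r : t0 \in facet_reps n (val s).
  by rewrite mem_undup mem_pmap -E; apply: map_f.
rewrite -big_filter filter_pred1_uniq ?undup_uniq // big_seq1 eta_incidence //.
move/orbit_repP: E; apply: alternating_orbit.
by case: (Gamma_alternating (set_valP t0)).
Qed.

(* For a non-alternating cone both sides vanish: an element of the stabilizer
   that reverses the orientation permutes the facets and changes all signs. *)
Lemma boundary_orbit_class n sigma : perfect_cone sigma ->
  (cone_dim sigma)%:Z = n + 1 ->
  diff (perfect_complex D) n (orbit_class D n sigma) =
  \sum_(rho <- facets sigma)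
    incidence (orient D rho) (orient D sigma) rho sigma *: orbit_class D (n - 1) rho.
Proof.
move=> ps ds; have pps := perfect_pointed ps.
have [alt|nalt] := pselect (alternating sigma).
  have [s /orbit_repP [h uh sE]] := orbit_rep_Some D alt ds.
  have pv := Gamma_perfect (set_valP s); have ppv := perfect_pointed pv.
  have [altv _] := Gamma_alternating (set_valP s).
  rewrite (orbit_classE (s := s)); last by exists h.
  rewrite boundary_generator sE.
  rewrite (perm_big _ (perm_facets_image (orbK uh) ppv)) big_map.
  rewrite [LHS]big_seq [RHS]big_seq; apply: eq_bigr => rho /(facetsP _ ppv) fr.
  rewrite (@orbit_class_orbit _ _ _ _ rho); last by exists h.
  have [ar|nar] := pselect (alternating rho); last first.
    by rewrite orbit_class_eq0 ?scaler0 // => -[].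
  rewrite !orient_act // (incidence_image (orbK uh)) //; exact: orient_orientation.
rewrite orbit_class_eq0 ?linear0; last by case.
have bX := vbasisP (lspan sigma); set X := vbasis _ : seq 'M[R]_g in bX.
have [h [uh hs hX]] : exists h, [/\ h \in unitmx, gl_act_cone h sigma = sigma &
    ~ (0 < basis_change_det X (map (congr_act h) X))].
  apply: contrapT => nh; apply: nalt; apply/(alternatingP bX); split=> // h uh hs.
  by apply: contrapT => nd; apply: nh; exists h.
have oS := orient_orientation D sigma.
have sgn : orientation_sign (map (congr_act h) @` orient D sigma) (orient D sigma) = -1.
  rewrite /orientation_sign; case: asboolP => // ho; case: hX.
  exact/(stabilizer_orientation uh hs oS bX).
set S := \sum_(_ <- _) _.
suff SN : S = - S.
  have S2 : (2 : rat) *: S = 0 by rewrite scaler_nat mulr2n {1}SN addNr.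
  by have := congr1 ( *:%R (2^-1 : rat)) S2; rewrite scaler0 scalerA mulVf // scale1r.
have facets_h : perm_eq (facets sigma) [seq congr_act h @` rho | rho <- facets sigma].
  by have := perm_facets_image (orbK uh) pps; rewrite [X in facets X]hs.
rewrite {1}/S (perm_big _ facets_h) big_map /S -sumrN.
rewrite [LHS]big_seq [RHS]big_seq; apply: eq_bigr => rho /(facetsP _ pps) fr.
rewrite (@orbit_class_orbit _ _ _ _ rho); last by exists h.
have [ar|nar] := pselect (alternating rho); last first.
  by rewrite orbit_class_eq0 ?scaler0 ?oppr0 // => -[].
rewrite -scaleNr orient_act //; congr (_ *: _).
have oR := orient_orientation D rho.
have oR' := orientation_image (orbK uh) oR.
have oS' : is_orientation (lspan sigma) (map (congr_act h) @` orient D sigma).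
  by rewrite -[in lspan _]hs; exact: (orientation_image (orbK uh) oS).
have fr' : is_facet (congr_act h @` rho) sigma.
  by rewrite -[X in is_facet _ X]hs; exact: facet_image (orbK uh) _ _ fr.
(* The facet keeps its transported orientation while that of [sigma] is compared with its reverse,
   so exactly one sign appears. *)
have := incidence_change pps fr' oR' oR' oS' oS.
rewrite sgn mulrN1 /orientation_sign asboolT // mulr1 => <-; congr (- _).
rewrite -(incidence_image (orbK uh) pps fr oR oS); congr incidence; exact/esym/hs.
Qed.

Lemma perfect_complexP : is_complex (perfect_complex D).
Proof.
move=> n x; elim/freeg_ind: x => [|x y xE yE|c s]; first by rewrite !linear0.
  by rewrite !linearD xE yE addr0.
rewrite !linearZZ; suff -> : diff (perfect_complex D) (n - 1)
  (diff (perfect_complex D) n << s >>) = 0 by rewrite scaler0.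
have [[ps _] ds] := Gamma_alternating (set_valP s).
set sigma := val s in ps ds *; have pps := perfect_pointed ps.
rewrite boundary_generator -/sigma linear_sum /=.
pose a rho := incidence (orient D rho) (orient D sigma) rho sigma.
pose b tau rho := incidence (orient D tau) (orient D rho) tau rho.
(* All facets of facets, in one list independent of [rho], so that the two summations can be
   exchanged. *)
pose T := undup (flatten [seq facets rho | rho <- facets sigma]).
have step rho : rho \in facets sigma ->
    diff (perfect_complex D) (n - 1) (a rho *: orbit_class D (n - 1) rho) =
    \sum_(tau <- T) if tau \in facets rho
      then (b tau rho * a rho) *: orbit_class D (n - 1 - 1) tau else 0.
  move=> fs; have /(facetsP _ pps) fr := fs; have pr := facet_perfect ps fr.
  rewrite linearZZ boundary_orbit_class //; last exact: facet_degree fr ds.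
  rewrite scaler_sumr -big_mkcond -big_filter.
  rewrite [RHS](perm_big (facets rho)) /=.
    by apply: eq_bigr => tau _; rewrite scalerA mulrC.
  apply: uniq_perm; rewrite ?filter_uniq ?undup_uniq ?facets_uniq // => tau.
  rewrite mem_filter; have [ft|//] := boolP (tau \in facets rho).
  by rewrite /= mem_undup; apply/flatten_mapP; exists rho.
rewrite big_seq (eq_bigr _ step) -big_seq exchange_big big1 // => tau _.
rewrite -big_mkcond -scaler_suml; have [/hasP[rho0 fs0 ft0]|nh] :=
  boolP (has (fun rho => tau \in facets rho) (facets sigma)); last first.
  by rewrite big_hasC // scale0r.
have fr0 : is_facet rho0 sigma by apply/facetsP.
have pp0 := perfect_pointed (facet_perfect ps fr0).
have ft : is_facet tau rho0 by apply/facetsP.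
have [rho1 [u [v [fr1 ft1 only u0 v1]]]] := facet_diamond pps fr0 ft.
have pp1 := perfect_pointed (facet_perfect ps fr1).
rewrite -big_filter (perm_big [:: rho0; rho1]) /=.
  rewrite big_cons big_seq1 /a /b.
  rewrite (incidence_diamond pp0 pp1 pps fr0 fr1 ft ft1 _ _ _ _ u0 v1) ?scale0r //;
    exact: orient_orientation.
have r01 : rho0 != rho1.
  by apply/eqP => rE; case: u0 => u0 u1 _; apply: u1; rewrite -rE.
apply: uniq_perm; rewrite ?filter_uniq ?facets_uniq //= ?inE ?r01 // => rho.
rewrite mem_filter !inE; apply/andP/orP => [[]|[] /eqP ->].
- move=> tr /(facetsP _ pps) fr.
  have /only[] // : is_facet tau rho.
    by apply/facetsP => //; exact: perfect_pointed (facet_perfect ps fr).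
  + by move=> ->; left.
  + by move=> ->; right.
- by split.
- by split; apply/facetsP.
Qed.

End Boundary.

(** * The short exact sequence *)

Lemma orientation_signC (R : realType) (V : vectType R) (o o' : set (seq V)) :
  orientation_sign o o' = orientation_sign o' o.
Proof.
by rewrite /orientation_sign; congr (if _ then _ else _); apply/asbool_equiv_eq; split.
Qed.

Section VoronoiProjection.
Variables (R : realType) (g : nat) (D : cone_choice R g).
Implicit Types (rho sigma tau : set 'M[R]_g) (n : int).

Lemma Omega_congr_act (h : 'M[int]_g) Q : h \in unitmx ->
  Omega Q -> @Omega R g (congr_act h Q).
Proof.
move=> uh; rewrite -[h in congr_act h]trmxK; apply: (Omega_pull (B := invmx h^T)).
by rewrite mulVmx // unitmx_tr.
Qed.

Lemma Omega_orbit rho sigma : same_orbit rho sigma ->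
  rho `&` @Omega R g !=set0 -> sigma `&` @Omega R g !=set0.
Proof.
move=> [h uh ->] [Q [rQ oQ]]; exists (congr_act h Q).
by split; [exists Q|exact: Omega_congr_act].
Qed.

Lemma voronoi_projU n (s : Gamma D n) : voronoi_proj D n << s >> =
  if insub (val s) is Some t then << (t : Gamma_bar D n) >> else 0.
Proof. exact: free_liftU. Qed.

Lemma voronoi_proj_in n (s : Gamma D n) (t : Gamma_bar D n) : val s = val t ->
  voronoi_proj D n << s >> = << t >>.
Proof. by move=> st; rewrite voronoi_projU st valK. Qed.

Lemma voronoi_proj_out n (s : Gamma D n) : ~ (val s `&` @Omega R g !=set0) ->
  voronoi_proj D n << s >> = 0.
Proof.
by move=> sO; rewrite voronoi_projU; case: insubP => // t /set_mem[_ /sO].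
Qed.

Lemma Gamma_barP n (s : Gamma D n) : val s `&` @Omega R g !=set0 ->
  exists t : Gamma_bar D n, val s = val t.
Proof.
move=> sO; have m : val s \in Gamma_bar D n by apply/mem_set; split; [exact: set_valP|].
by exists (SigSub m).
Qed.

(** Facets of a cone missing [Omega] miss it too, and [Omega] is stable under the group; hence the
    cones killed by [voronoi_proj] span a subcomplex. *)
Lemma delta_Omega n (s : Gamma D n) sigma' : delta D sigma' (val s) != 0 ->
  sigma' `&` @Omega R g !=set0 -> val s `&` @Omega R g !=set0.
Proof.
have ps := Gamma_perfect (set_valP s).
move=> d0 tO; apply: contrapT => sO; case/eqP: d0.
rewrite deltaE // big_seq_cond big1 //.
move=> rho /andP[/(facetsP _ (perfect_pointed ps)) [fr _] /asboolP sr].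
by case: sO; have [Q [rQ oQ]] := Omega_orbit sr tO; exists Q; split; [exact: face_sub rQ|].
Qed.

Lemma voronoi_proj_chain : is_chain_map (voronoi_proj D).
Proof.
move=> n x; elim/freeg_ind: x => [|x y xE yE|c s]; first by rewrite !linear0.
  by rewrite !linearD xE yE.
rewrite !linearZZ; congr (_ *: _).
have ps := Gamma_perfect (set_valP s).
pose T := facet_reps D n (val s).
rewrite (@cone_complex_diffE _ _ _ _ _ T); last 2 first.
- exact: undup_uniq.
- by move=> t; exact: delta_outside.
rewrite linear_sum /=; under eq_bigr => t _ do rewrite linearZZ voronoi_projU.
have [sO|sO] := pselect (val s `&` @Omega R g !=set0); last first.
  rewrite voronoi_proj_out // linear0 big1 // => t _.
  case: insubP => [u /set_mem[_ tO] _|_]; last by rewrite scaler0.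
  have [->|/(@delta_Omega n s)/(_ tO)/sO//] := eqVneq (delta D (val t) (val s)) 0.
  by rewrite scale0r.
have [u su] := Gamma_barP sO; rewrite (voronoi_proj_in su) su.
pose T' := pmap (fun t : Gamma D (n - 1) => insub (val t) : option (Gamma_bar D (n - 1))) T.
rewrite (@cone_complex_diffE _ _ _ _ _ T').
- rewrite /T' big_pmap; apply: eq_bigr => t _.
  case: insubP => [w _ wt|_]; rewrite ?scaler0 //.
  by congr (delta D _ _ *: _); exact/esym/wt.
- apply: (pmap_uniq (g := fun w : Gamma_bar D (n - 1) =>
      SigSub (mem_set (proj1 (set_valP w))) : Gamma D (n - 1))).
    move=> t; case: insubP => //= w _ wt; apply: val_inj; exact: wt.
  exact: undup_uniq.
- move=> t nt; rewrite -su.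
  have Gt : val t \in Gamma D (n - 1) by apply/mem_set/(proj1 (set_valP t)).
  apply: (@delta_outside _ _ D n (val s) (SigSub Gt)) => //.
  apply: contra nt => tT; rewrite mem_pmap; apply/mapP; exists (SigSub Gt) => //=.
  by rewrite valK.
Qed.

End VoronoiProjection.

(** * The inclusion of the smaller perfect complex and the degreewise splitting *)

Section Inclusion.
Variables (R : realType) (g : nat) (D' : cone_choice R g) (D : cone_choice R g.+1).
Implicit Types (rho sigma tau : set 'M[R]_g) (n : int).

Let wid : 'M[R]_g -> 'M[R]_g.+1 := congr_act (widen_mx g).
Let widK : cancel wid (congr_act (narrow_mx g)) := congr_actK (narrow_widen_mx g).

(** Compares the orientation transported from [D'] with the one given by [D]. *)
Definition widen_sign sigma : rat :=
  orientation_sign (map wid @` orient D' sigma) (orient D (wid @` sigma)).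

Definition inclusion : graded_map (perfect_complex D') (perfect_complex D) := fun n =>
  @free_lift (Gamma D' n) {freeg (Gamma D n) / rat}
    (fun s => widen_sign (val s) *: orbit_class D n (wid @` val s)).

Definition narrow_rep n (s : Gamma D n) : option (Gamma D' n) :=
  if pselect (exists s' : Gamma D' n, same_orbit (wid @` val s') (val s)) is left e
  then Some (projT1 (cid e)) else None.

(** With [voronoi_section], a linear splitting in each separate degree, which is all that exactness
    asks for. *)
Definition retraction n :=
  @free_lift (Gamma D n) {freeg (Gamma D' n) / rat}
    (fun s => if narrow_rep s is Some s' then widen_sign (val s') *: << s' >> else 0).

Definition voronoi_section n :=
  @free_lift (Gamma_bar D n) {freeg (Gamma D n) / rat}
    (fun t => << (SigSub (mem_set (proj1 (set_valP t))) : Gamma D n) >>).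

Lemma inclusionU n (s : Gamma D' n) : inclusion n << s >> =
  widen_sign (val s) *: orbit_class D n (wid @` val s).
Proof. exact: free_liftU. Qed.

Lemma wid_perfect sigma : perfect_cone sigma -> perfect_cone (wid @` sigma).
Proof. exact: perfect_cone_image (narrow_widen_mx g). Qed.

Lemma wid_alternating sigma : perfect_cone sigma ->
  alternating (wid @` sigma) <-> alternating sigma.
Proof. exact: alternating_image (narrow_widen_mx g). Qed.

Lemma wid_orbit sigma sigma' : perfect_cone sigma ->
  same_orbit (wid @` sigma) (wid @` sigma') <-> same_orbit sigma sigma'.
Proof. exact: same_orbit_image (narrow_widen_mx g) _ _. Qed.

Lemma wid_dim sigma : cone_dim (wid @` sigma) = cone_dim sigma.
Proof. exact: cone_dim_image widK _. Qed.

(** An [h] acting on the small cone lifts to a [k] acting on the widened one; both compared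
    orientations are transported by [k], so their relative sign is unchanged. *)
Lemma widen_sign_orbit sigma sigma' : alternating sigma -> same_orbit sigma sigma' ->
  widen_sign sigma' = widen_sign sigma.
Proof.
move=> alt [h uh ->]; have ps : perfect_cone sigma by case: alt.
have [k uk kA] := unimodular_lift (narrow_widen_mx g) uh.
have walt : alternating (wid @` sigma) by apply/wid_alternating.
have kK := congr_actK (R := R) (mulVmx uk).
rewrite /widen_sign orient_act //.
have -> : wid @` (congr_act h @` sigma) = congr_act k @` (wid @` sigma).
  by rewrite /wid -!image_congr_act_mul kA.
rewrite orient_act //.
have -> : map wid @` (map (congr_act h) @` orient D' sigma) =
    map (congr_act k) @` (map wid @` orient D' sigma).
  rewrite !image_comp; congr image; apply/funext => X /=.
  by rewrite -!map_comp; apply: eq_map => Q /=; rewrite /wid -!congr_act_mul kA.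
apply: (orientation_sign_image kK (sigma := wid @` sigma)).
  exact: (orientation_image widK (orient_orientation D' sigma)).
exact: orient_orientation.
Qed.

Lemma inclusion_orbit_class n sigma : perfect_cone sigma ->
  inclusion n (orbit_class D' n sigma) =
  widen_sign sigma *: orbit_class D n (wid @` sigma).
Proof.
move=> ps; rewrite {1}/orbit_class; case E: orbit_rep => [s|].
  move/orbit_repP: E => ss; have [alt _] := Gamma_alternating (set_valP s).
  rewrite inclusionU -(widen_sign_orbit alt ss); congr (_ *: _).
  by apply/esym/orbit_class_orbit/wid_orbit; first by case: alt.
rewrite linear0 [orbit_class _ _ _]orbit_class_eq0 ?scaler0 //.
rewrite (wid_alternating ps) wid_dim => -[alt dim].
by have [s] := orbit_rep_Some D' alt dim; rewrite E.
Qed.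

Lemma inclusion_chain : is_chain_map inclusion.
Proof.
move=> n x; elim/freeg_ind: x => [|x y xE yE|c s]; first by rewrite !linear0.
  by rewrite !linearD xE yE.
rewrite !linearZZ; congr (_ *: _); set sigma := val s.
have ps : perfect_cone sigma := Gamma_perfect (set_valP s).
have pps := perfect_pointed ps; have [_ ds] := Gamma_alternating (set_valP s).
rewrite boundary_generator inclusionU linearZZ boundary_orbit_class; last 2 first.
- exact: wid_perfect.
- by rewrite wid_dim.
rewrite (perm_big _ (perm_facets_image widK pps)) big_map scaler_sumr linear_sum.
rewrite [LHS]big_seq [RHS]big_seq; apply: eq_bigr => rho /(facetsP _ pps) fr.
rewrite linearZZ inclusion_orbit_class; last exact: facet_perfect ps fr.
rewrite !scalerA; congr (_ *: _).
have oR := orient_orientation D' rho; have oS := orient_orientation D' sigma.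
(* The two orientation signs in this identity are [widen_sign] of [sigma] and of [rho], up to the
   order of arguments. *)
have := incidence_change (pointed_cone_image widK pps) (facet_image widK fr)
  (orient_orientation D (wid @` rho)) (orientation_image widK oR)
  (orient_orientation D (wid @` sigma)) (orientation_image widK oS).
rewrite (incidence_image widK pps fr oR oS) /widen_sign => E.
by rewrite orientation_signC -E mulrC orientation_signC.
Qed.

Lemma wid_not_Omega sigma : ~ ((wid @` sigma) `&` @Omega R g.+1 !=set0).
Proof. by move=> [_ [[Q _ <-]]]; exact: widen_mx_degenerate. Qed.

Lemma voronoi_proj_inclusion n x : voronoi_proj D n (inclusion n x) = 0.
Proof.
elim/freeg_ind: x => [|x y xE yE|c s]; first by rewrite !linear0.
  by rewrite !linearD xE yE addr0.
rewrite !linearZZ inclusionU linearZZ /orbit_class.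
case E: orbit_rep => [t|]; last by rewrite linear0 !scaler0.
rewrite voronoi_proj_out ?scaler0 // => /(Omega_orbit _) h.
by move/orbit_repP: E => /h; exact: wid_not_Omega.
Qed.

Lemma retraction_inclusion n : cancel (inclusion n) (retraction n).
Proof.
move=> x; elim/freeg_ind: x => [|x y xE yE|c s]; first by rewrite !linear0.
  by rewrite !linearD xE yE.
rewrite !linearZZ inclusionU linearZZ; congr (_ *: _).
have [alt ds] := Gamma_alternating (set_valP s).
have ps : perfect_cone (val s) by case: alt.
have [t tE] : exists t, orbit_rep D n (wid @` val s) = Some t.
  by apply: orbit_rep_Some; [exact/wid_alternating|rewrite wid_dim].
have ts := (orbit_repP _ _).2 tE.
rewrite (orbit_classE ts) /retraction free_liftU /narrow_rep.
case: pselect => [e|[]]; last by exists s; exact: same_orbit_sym.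
case: (cid e) => s' /= s't; have ss' : s' = s.
  apply: val_inj; apply: (Gamma_unique (set_valP s') (set_valP s) (rho := val s)).
    apply/wid_orbit; first exact: Gamma_perfect (set_valP s').
    exact: same_orbit_trans s't ts.
  exact: same_orbit_refl.
by rewrite ss' scalerA orientation_sign_sqr scale1r.
Qed.

Lemma voronoi_proj_section n : cancel (voronoi_section n) (voronoi_proj D n).
Proof.
move=> x; elim/freeg_ind: x => [|x y xE yE|c t]; first by rewrite !linear0.
  by rewrite !linearD xE yE.
rewrite !linearZZ; congr (_ *: _); rewrite /voronoi_section free_liftU.
exact: voronoi_proj_in.
Qed.

(** A representative meeting [Omega] is recovered by the section. Any other is equivalent to a
    widened cone and is recovered by the retraction, where [widen_sign] occurs squared. *)
Lemma perfect_complex_split n x :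
  x = inclusion n (retraction n x) + voronoi_section n (voronoi_proj D n x).
Proof.
elim/freeg_ind: x => [|x y xE yE|c s]; first by rewrite !linear0 addr0.
  by rewrite !linearD {1}xE {1}yE addrACA.
rewrite !linearZZ -scalerDr; congr (_ *: _).
rewrite /retraction free_liftU /narrow_rep.
have [sO|sO] := pselect (val s `&` @Omega R g.+1 !=set0).
  have [t st] := Gamma_barP sO; rewrite (voronoi_proj_in st) /voronoi_section free_liftU.
  case: pselect => [e|_].
    have [s' s's] := e.
    by have := wid_not_Omega (Omega_orbit (same_orbit_sym s's) sO).
  by rewrite linear0 add0r; congr << _ >>; apply: val_inj.
rewrite voronoi_proj_out // linear0 addr0.
case: pselect => [e|[]].
  case: (cid e) => s' /= s's; rewrite linearZZ inclusionU.
  by rewrite scalerA orientation_sign_sqr scale1r (orbit_classE (same_orbit_sym s's)).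
have [alt ds] := Gamma_alternating (set_valP s).
have [] := perfect_cone_degenerate (Gamma_perfect (set_valP s)).
  by apply/seteqP; split=> // Q sQ; case: sO; exists Q.
move=> tau [h [pt uh sE]].
have ts : same_orbit (wid @` tau) (val s) by exists h.
have at_ : alternating tau.
  by apply/wid_alternating => //; apply: alternating_orbit alt (same_orbit_sym ts).
have dt : (cone_dim tau)%:Z = n + 1 by rewrite -wid_dim -(cone_dim_orbit ts).
have [s' /orbit_repP s't] := orbit_rep_Some D' at_ dt.
exists s'; apply: same_orbit_trans ts; apply/wid_orbit => //.
exact: Gamma_perfect (set_valP s').
Qed.

End Inclusion.

Theorem theorem4p13 (R : realType) (g : nat) (hg : (1 <= g)%N)
    (D' : cone_choice R g.-1) (D : cone_choice R g) :
  exists i : graded_map (perfect_complex D') (perfect_complex D),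
    short_exact_sequence i (voronoi_proj D).
Proof.
case: g hg D' D => // g _ D' D; exists (inclusion D' D).
have pisK := @voronoi_proj_section R g D.
have pchain := @voronoi_proj_chain R g.+1 D.
split; split.
- exact: perfect_complexP.
- exact: perfect_complexP.
(* Every Voronoi chain is a projection, so its double boundary is the projection of a double
   boundary in the perfect complex. *)
- move=> n x; rewrite -[x](pisK n) -!pchain.
  by rewrite perfect_complexP linear0.
- exact: inclusion_chain.
- exact: pchain.
move=> n; split.
- exact: can_inj (@retraction_inclusion R g D' D n).
- apply/seteqP; split=> [_ [x _ <-]|y py]; first exact: voronoi_proj_inclusion.
  have {}py : voronoi_proj D n y = 0 := py.
  exists (retraction D' D n y) => //.
  by have := @perfect_complex_split R g D' D n y; rewrite py linear0 addr0 => /esym.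
- by apply/seteqP; split=> // z _; exists (voronoi_section D n z) => //; exact: pisK.
Qed.
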